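(* For every non-decreasing function $\delta\colon(0,1)\to(0,1)$ there exist a surjective and four-valent analytic map $\psi\colon\mathbb{D}\to\mathbb{D}$ and $0<h_0<1$ such that for all $0<h\le h_0$, $$m\big(\{z\in\mathbb{T}\,;\ |\psi^*(z)|\ge1-h\}\big)\le\delta(h).$$
   Context: $\mathbb{D}$ is the open unit disk, $\mathbb{T}=\partial\mathbb{D}$, $m$ the normalized Lebesgue measure on $\mathbb{T}$, and $\psi^*(\xi)=\lim_{r\to1^-}\psi(r\xi)$ is the a.e. defined radial limit. Four-valent means every point has at most four preimages. *)

(* Defs.v *)
From Stdlib Require Import Reals Lra List.
Open Scope R_scope.

Definition Cpx : Type := (R * R)%type.
Definition Cadd (z w : Cpx) : Cpx := (fst z + fst w, snd z + snd w).
Definition Csub (z w : Cpx) : Cpx := (fst z - fst w, snd z - snd w).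
Definition Cmul (z w : Cpx) : Cpx :=
  (fst z * fst w - snd z * snd w, fst z * snd w + snd z * fst w).
Definition Cinv (z : Cpx) : Cpx :=
  let d := fst z * fst z + snd z * snd z in (fst z / d, - snd z / d).
Definition Cdiv (z w : Cpx) : Cpx := Cmul z (Cinv w).
Definition Cscal (r : R) (z : Cpx) : Cpx := (r * fst z, r * snd z).
Definition Cnorm (z : Cpx) : R := sqrt (fst z * fst z + snd z * snd z).

Definition inD (z : Cpx) : Prop := Cnorm z < 1.

Definition expi (t : R) : Cpx := (cos t, sin t).

Definition analytic_on_D (f : Cpx -> Cpx) : Prop :=
  forall z, inD z -> exists L : Cpx, forall eps, eps > 0 ->
    exists del, del > 0 /\ forall w, 0 < Cnorm w < del -> inD (Cadd z w) ->
      Cnorm (Csub (Cdiv (Csub (f (Cadd z w)) (f z)) w) L) < eps.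

Definition maps_D_onto_D (f : Cpx -> Cpx) : Prop :=
  (forall z, inD z -> inD (f z)) /\
  (forall w, inD w -> exists z, inD z /\ f z = w).

Definition four_valent (f : Cpx -> Cpx) : Prop :=
  forall (w : Cpx) (l : list Cpx), NoDup l ->
    (forall z, In z l -> inD z /\ f z = w) -> (length l <= 4)%nat.

Definition radial_limit (f : Cpx -> Cpx) (t : R) (l : Cpx) : Prop :=
  forall eps, eps > 0 -> exists del, del > 0 /\
    forall r, 1 - del < r < 1 -> Cnorm (Csub (f (Cscal r (expi t))) l) < eps.

Definition outer_measure_le (A : R -> Prop) (c : R) : Prop :=
  forall eps, eps > 0 -> exists a b : nat -> R,
    (forall n, a n <= b n) /\
    (forall x, A x -> exists n, a n < x < b n) /\
    (forall N, sum_f_R0 (fun n => b n - a n) N <= c + eps).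

(* normalized arc-length measure m on T, via t |-> e^{it}, t in [0, 2pi):
   m(E) <= c  iff  Lebesgue(preimage) <= 2 pi c *)
Definition m_le (E : R -> Prop) (c : R) : Prop :=
  outer_measure_le (fun t => 0 <= t < 2 * PI /\ E t) (2 * PI * c).

Definition big_boundary_set (f : Cpx -> Cpx) (h : R) (t : R) : Prop :=
  exists l, radial_limit f t l /\ Cnorm l >= 1 - h.

(* Main.v *)
(** A primitive [F] of [f = - p^2 / 3 + i p], with [p (s) = sum_n 2^-n r_n / (s + r_n^2)] slowly varying,
    maps the half-strip [Re s >= 0, |Im s| < pi/2] onto a thin curved strip in the right half-plane that
    climbs along the imaginary axis.  There [p] is nearly real and [|p'|] is much smaller than [p^2], so
    the chord slopes of [F] are close to [- P^2/3 + i P] with [P = Re p].  Hence two points with equal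
    [Re F] satisfy [Im (F s2 - F s1) = - q (Im s2 - Im s1)] with [q] close to 3: every vertical line meets
    the image of [F] in a segment of length about [3 pi], between [2 pi] and [4 pi].  So [exp (- F)] is
    two-valent and covers an annulus [rho < |x| < 1].  The half-strip is reached from the disc by the
    univalent map [s = - log ((1 - z) / 2)], whose range contains every [s] with [|Im s| <= 5/4] and [Re s]
    large.  Squaring a Moebius map with zero [a > rho] fills the missing disc at the cost of a factor 2 in
    the valence.

    On the circle [Re s = - log |sin (t/2)|], while [Re F] stays above a multiple of [4^-n]
    as long as [Re s <= r_n^2].  So [Re F] small forces [|sin (t/2)| < exp (- r_n^2)], and the [r_n] may be
    taken as large as [delta] requires. *)

(* Two demands compete: [Re F] must decay along the strip as slowly as [delta] prescribes, yet the
   valence must not depend on that speed. Scale invariance separates them. If the chord slope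
   between two points is [- u + i v] and [Re F] agrees at both, eliminating the horizontal
   displacement leaves [q = v ^ 2 / u + u]. With [u] near [P ^ 2 / 3] and [v] near [P] the quotient
   is near 3 whatever the size of [P]. The difficulty is that [u] and [v] are read off the field at
   different points of the segment; they can be compared because [1 / p] has a small Lipschitz
   constant.

   The residue [2^-n r_n] is [2^-n] times the square root of the distance of the pole from 0. So the
   nth term of [p] has L2 norm [2^-n] on the positive half-axis however far its pole lies: the
   integral of [p ^ 2] converges for every choice of the [r_n], and half of the nth share is still
   ahead at [Re s = r_n ^ 2]. The term of index 0 has a fixed pole and secures the slow variation,
   which leaves the other [r_n] free above a constant threshold. *)
Require Import Defs.
From Stdlib Require Import Reals ZArith List Lra Lia Psatz ClassicalEpsilon.
From Coquelicot Require Import Coquelicot.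
Open Scope R_scope.

(** * Complex differentiability *)

(* Differentiability with a quadratic error: all the functions involved are C^{1,1}, and this form
   composes without choosing epsilons. *)
Definition cderiv (f : C -> C) (z l : C) : Prop :=
  exists A del, 0 <= A /\ 0 < del /\ forall w : C, Cmod w < del ->
    Cmod (f (z + w) - f z - l * w)%C <= A * (Cmod w) ^ 2.

Lemma Cmod_minus_triangle (x y : C) : Cmod (x - y)%C <= Cmod x + Cmod y.
Proof.
  unfold Cminus. eapply Rle_trans; [apply Cmod_triangle|]. rewrite Cmod_opp. lra.
Qed.

Lemma Cmod_minus_sym (x y : C) : Cmod (x - y)%C = Cmod (y - x)%C.
Proof. rewrite <- Cmod_opp. f_equal. ring. Qed.

Lemma Cmod_sub_ge (x y : C) : Cmod x - Cmod y <= Cmod (x - y)%C.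
Proof.
  pose proof (Cmod_triangle (x - y)%C y) as H.
  replace (x - y + y)%C with x in H by ring. lra.
Qed.

Lemma Re_le (z : C) : Re z <= Cmod z.
Proof. pose proof (re_le_Cmod z). pose proof (Rle_abs (Re z)). lra. Qed.

Lemma im_le_Cmod (z : C) : Rabs (Im z) <= Cmod z.
Proof.
  eapply Rle_trans; [apply Rmax_r|]. apply Rmax_Cmod.
Qed.

Lemma Cmod_le_sum (z : C) : Cmod z <= Rabs (Re z) + Rabs (Im z).
Proof.
  replace z with ((RtoC (Re z)) + Ci * (RtoC (Im z)))%C.
  - eapply Rle_trans; [apply Cmod_triangle|].
    rewrite Cmod_mult, Cmod_Ci, !Cmod_R.
    apply Req_le. simpl. f_equal; [f_equal|rewrite Rmult_1_l; f_equal]; ring.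
  - destruct z; unfold Cplus, Cmult, Ci, RtoC; simpl. f_equal; ring.
Qed.

Lemma cderiv_lip f z l : cderiv f z l ->
  exists M del, 0 <= M /\ 0 < del /\ forall w : C, Cmod w < del ->
    Cmod (f (z + w) - f z)%C <= M * Cmod w.
Proof.
  intros (A & d & HA & Hd & H). exists (A + Cmod l), (Rmin d 1).
  pose proof (Cmod_ge_0 l).
  split; [lra|]. split; [apply Rmin_pos; lra|].
  intros w Hw. pose proof (Rmin_l d 1). pose proof (Rmin_r d 1).
  specialize (H w ltac:(lra)). pose proof (Cmod_ge_0 w).
  replace (f (z + w) - f z)%C with ((f (z + w) - f z - l * w) + l * w)%C by ring.
  eapply Rle_trans; [apply Cmod_triangle|]. rewrite Cmod_mult.
  assert (A * Cmod w ^ 2 <= A * Cmod w) by (apply Rmult_le_compat_l; nra). nra.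
Qed.

Lemma cderiv_ext f g z l : (forall x, f x = g x) -> cderiv f z l -> cderiv g z l.
Proof.
  intros E (A & d & HA & Hd & H). exists A, d. repeat split; auto.
  intros w Hw. rewrite <- !E. auto.
Qed.

Lemma cderiv_comp f g z l m : cderiv g z m -> cderiv f (g z) l ->
  cderiv (fun x => f (g x)) z (l * m)%C.
Proof.
  intros Hg Hf. destruct (cderiv_lip _ _ _ Hg) as (M & d1 & HM & Hd1 & HL).
  destruct Hg as (A & d2 & HA & Hd2 & Hg). destruct Hf as (B & d3 & HB & Hd3 & Hf).
  pose proof (Cmod_ge_0 l).
  assert (HD : 0 < d3 / (M + 1)) by (apply Rdiv_lt_0_compat; lra).
  exists (B * M ^ 2 + Cmod l * A), (Rmin d1 (Rmin d2 (d3 / (M + 1)))).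
  split; [nra|]. split; [repeat apply Rmin_pos; assumption|].
  intros w Hw.
  assert (Cmod w < d1 /\ Cmod w < d2 /\ Cmod w < d3 / (M + 1)) as (W1 & W2 & W3).
  { pose proof (Rmin_l d1 (Rmin d2 (d3 / (M + 1)))).
    pose proof (Rmin_r d1 (Rmin d2 (d3 / (M + 1)))).
    pose proof (Rmin_l d2 (d3 / (M + 1))).
    pose proof (Rmin_r d2 (d3 / (M + 1))). lra. }
  specialize (HL w W1). specialize (Hg w W2). pose proof (Cmod_ge_0 w).
  set (k := (g (z + w) - g z)%C) in *.
  assert (K : Cmod k < d3).
  { apply Rle_lt_trans with (M * Cmod w); [exact HL|].
    apply Rle_lt_trans with ((M + 1) * Cmod w); [nra|].
    apply Rmult_lt_reg_r with (/ (M + 1)); [apply Rinv_0_lt_compat; lra|].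
    field_simplify; [|lra|lra]. unfold Rdiv in W3. lra. }
  specialize (Hf k K). replace (g z + k)%C with (g (z + w))%C in Hf by (unfold k; ring).
  replace (f (g (z + w)) - f (g z) - l * m * w)%C with
    ((f (g (z + w)) - f (g z) - l * k) + l * (k - m * w))%C by ring.
  eapply Rle_trans; [apply Cmod_triangle|]. rewrite Cmod_mult.
  assert (B * Cmod k ^ 2 <= B * (M * Cmod w) ^ 2).
  { apply Rmult_le_compat_l; [lra|]. apply pow_incr. split; [apply Cmod_ge_0|exact HL]. }
  assert (Cmod l * Cmod (k - m * w) <= Cmod l * (A * Cmod w ^ 2))
    by (apply Rmult_le_compat_l; assumption).
  nra.
Qed.

Lemma cderiv_const c z : cderiv (fun _ => c) z 0%C.
Proof.
  exists 0, 1. repeat split; try lra. intros w _.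
  replace (c - c - 0 * w)%C with (RtoC 0) by ring. rewrite Cmod_0. lra.
Qed.

Lemma cderiv_id z : cderiv (fun x => x) z 1%C.
Proof.
  exists 0, 1. repeat split; try lra. intros w _.
  replace (z + w - z - 1 * w)%C with (RtoC 0) by ring. rewrite Cmod_0. lra.
Qed.

Lemma cderiv_plus f g z l m : cderiv f z l -> cderiv g z m ->
  cderiv (fun x => f x + g x)%C z (l + m)%C.
Proof.
  intros (A & d2 & HA & Hd2 & Hg) (B & d3 & HB & Hd3 & Hf).
  exists (A + B), (Rmin d2 d3). split; [lra|]. split; [apply Rmin_pos; lra|].
  intros w Hw. pose proof (Rmin_l d2 d3). pose proof (Rmin_r d2 d3).
  specialize (Hg w ltac:(lra)). specialize (Hf w ltac:(lra)).
  replace (f (z + w) + g (z + w) - (f z + g z) - (l + m) * w)%C with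
    ((f (z + w) - f z - l * w) + (g (z + w) - g z - m * w))%C by ring.
  eapply Rle_trans; [apply Cmod_triangle|]. lra.
Qed.

Lemma cderiv_mult f g z l m : cderiv f z l -> cderiv g z m ->
  cderiv (fun x => f x * g x)%C z (l * g z + f z * m)%C.
Proof.
  intros Hf Hg.
  destruct (cderiv_lip _ _ _ Hf) as (M & d1 & HM & Hd1 & HL).
  destruct (cderiv_lip _ _ _ Hg) as (N & d4 & HN & Hd4 & HL').
  destruct Hf as (A & d2 & HA & Hd2 & Hf). destruct Hg as (B & d3 & HB & Hd3 & Hg).
  pose proof (Cmod_ge_0 (f z)). pose proof (Cmod_ge_0 (g z)).
  exists (Cmod (f z) * B + Cmod (g z) * A + M * N), (Rmin (Rmin d1 d2) (Rmin d3 d4)).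
  split; [nra|]. split; [repeat apply Rmin_pos; assumption|].
  intros w Hw.
  assert (Cmod w < d1 /\ Cmod w < d2 /\ Cmod w < d3 /\ Cmod w < d4) as (W1 & W2 & W3 & W4).
  { pose proof (Rmin_l (Rmin d1 d2) (Rmin d3 d4)).
    pose proof (Rmin_r (Rmin d1 d2) (Rmin d3 d4)).
    pose proof (Rmin_l d1 d2). pose proof (Rmin_r d1 d2).
    pose proof (Rmin_l d3 d4). pose proof (Rmin_r d3 d4). lra. }
  specialize (HL w W1). specialize (HL' w W4). specialize (Hf w W2). specialize (Hg w W3).
  pose proof (Cmod_ge_0 w).
  replace (f (z + w) * g (z + w) - f z * g z - (l * g z + f z * m) * w)%C with
    (f z * (g (z + w) - g z - m * w) + g z * (f (z + w) - f z - l * w)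
     + (f (z + w) - f z) * (g (z + w) - g z))%C by ring.
  eapply Rle_trans; [apply Cmod_triangle|].
  apply Rle_trans with (Cmod (f z) * (B * Cmod w ^ 2) + Cmod (g z) * (A * Cmod w ^ 2)
    + (M * Cmod w) * (N * Cmod w)); [|nra].
  apply Rplus_le_compat.
  - eapply Rle_trans; [apply Cmod_triangle|]. rewrite !Cmod_mult.
    apply Rplus_le_compat; apply Rmult_le_compat_l; assumption.
  - rewrite Cmod_mult. apply Rmult_le_compat; try assumption; apply Cmod_ge_0.
Qed.

Lemma cderiv_scal c f z l : cderiv f z l -> cderiv (fun x => c * f x)%C z (c * l)%C.
Proof.
  intros H. replace (c * l)%C with (0 * f z + c * l)%C by ring.
  apply (cderiv_mult (fun _ => c)); [apply cderiv_const|exact H].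
Qed.

Lemma cderiv_Cinv (z : C) : z <> 0%C -> cderiv Cinv z (- / (z * z))%C.
Proof.
  intros Hz. pose proof (proj1 (Cmod_gt_0 z) Hz) as Hm.
  exists (2 / Cmod z ^ 3), (Cmod z / 2).
  split. { apply Rlt_le, Rdiv_lt_0_compat; [lra|]. apply pow_lt; lra. }
  split; [lra|]. intros w Hw.
  assert (Hl : Cmod z / 2 <= Cmod (z + w)).
  { pose proof (Cmod_sub_ge z (- w)%C) as H. rewrite Cmod_opp in H.
    replace (z - - w)%C with (z + w)%C in H by ring. lra. }
  assert (Hn : (z + w)%C <> 0%C) by (apply Cmod_gt_0; lra).
  replace (/ (z + w) - / z - - / (z * z) * w)%C with (w * w * / (z * z * (z + w)))%C
    by (field; auto).
  rewrite !Cmod_mult, Cmod_inv, !Cmod_mult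
    by (repeat apply Cmult_neq_0; assumption).
  apply Rle_trans with (Cmod w * Cmod w * / (Cmod z * Cmod z * (Cmod z / 2))).
  - apply Rmult_le_compat_l; [apply Rmult_le_pos; apply Cmod_ge_0|].
    apply Rinv_le_contravar; [repeat apply Rmult_lt_0_compat; lra|]. apply Rmult_le_compat_l; nra.
  - apply Req_le. field. lra.
Qed.

Lemma cderiv_inv (f : C -> C) (z l : C) : f z <> 0%C -> cderiv f z l ->
  cderiv (fun x => / f x)%C z (- / (f z * f z) * l)%C.
Proof. intros Hz H. apply (cderiv_comp Cinv f); [exact H|apply cderiv_Cinv, Hz]. Qed.

Lemma is_derive_quadratic (f : R -> R) (t l A del : R) : 0 < del ->
  (forall h, Rabs h < del -> Rabs (f (t + h) - f t - l * h) <= A * h ^ 2) ->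
  is_derive f t l.
Proof.
  intros Hd H. apply is_derive_Reals. intros eps Heps.
  assert (HA : 0 < Rabs A + 1) by (pose proof (Rabs_pos A); lra).
  assert (HD : 0 < Rmin del (eps / (Rabs A + 1))).
  { apply Rmin_pos; [lra|]. apply Rdiv_lt_0_compat; lra. }
  exists (mkposreal _ HD). intros h Hh Hlt. simpl in Hlt.
  pose proof (Rmin_l del (eps / (Rabs A + 1))).
  pose proof (Rmin_r del (eps / (Rabs A + 1))).
  specialize (H h ltac:(lra)).
  assert (Hp : 0 < Rabs h) by (apply Rabs_pos_lt, Hh).
  replace ((f (t + h) - f t) / h - l) with ((f (t + h) - f t - l * h) / h) by (field; auto).
  unfold Rdiv. rewrite Rabs_mult, Rabs_inv.
  apply Rle_lt_trans with (A * h ^ 2 * / Rabs h).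
  { apply Rmult_le_compat_r; [left; apply Rinv_0_lt_compat; lra|exact H]. }
  replace (h ^ 2) with (Rabs h * Rabs h) by (rewrite <- Rabs_mult, Rabs_pos_eq; nra).
  replace (A * (Rabs h * Rabs h) * / Rabs h) with (A * Rabs h) by (field; lra).
  pose proof (Rle_abs A).
  apply Rle_lt_trans with ((Rabs A + 1) * Rabs h); [nra|].
  apply Rlt_le_trans with ((Rabs A + 1) * (eps / (Rabs A + 1))).
  - apply Rmult_lt_compat_l; lra.
  - apply Req_le. field. lra.
Qed.

(** The factor [c] lets one statement serve all real functionals of [F]: [c = 1] gives the real
    part, [c = - Ci] the imaginary part, other values the oblique combinations needed for chords. *)
Lemma is_derive_segment (F : C -> C) (g s0 D c : C) (t : R) :
  cderiv F (s0 + RtoC t * D)%C g ->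
  is_derive (fun u : R => Re (c * F (s0 + RtoC u * D))%C) t (Re (c * D * g)%C).
Proof.
  intros (A & del & HA & Hd & H).
  pose proof (Cmod_ge_0 D). pose proof (Cmod_ge_0 c).
  apply is_derive_quadratic with (A := Cmod c * A * Cmod D ^ 2) (del := del / (Cmod D + 1)).
  { apply Rdiv_lt_0_compat; lra. }
  intros h Hh.
  assert (Hw : Cmod (RtoC h * D)%C < del).
  { rewrite Cmod_mult, Cmod_R. pose proof (Rabs_pos h).
    apply Rle_lt_trans with (Rabs h * (Cmod D + 1)); [nra|].
    apply Rlt_le_trans with (del / (Cmod D + 1) * (Cmod D + 1));
      [apply Rmult_lt_compat_r; lra|]. apply Req_le. field. lra. }
  specialize (H _ Hw).
  replace (s0 + RtoC (t + h) * D)%C with (s0 + RtoC t * D + RtoC h * D)%C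
    by (rewrite RtoC_plus; ring).
  set (z := (s0 + RtoC t * D)%C) in *. set (w := (RtoC h * D)%C) in *.
  replace (Re (c * F (z + w))%C - Re (c * F z)%C - Re (c * D * g)%C * h)
    with (Re (c * (F (z + w) - F z - g * w))%C).
  2:{ generalize (F (z + w)%C) (F z). intros U V. unfold w, Re. destruct U, V, c, D, g. simpl. ring. }
  eapply Rle_trans; [apply re_le_Cmod|]. rewrite Cmod_mult.
  apply Rle_trans with (Cmod c * (A * Cmod w ^ 2)); [apply Rmult_le_compat_l; auto|].
  unfold w. rewrite Cmod_mult, Cmod_R. rewrite Rpow_mult_distr, pow2_abs. nra.
Qed.

(** A complex-valued function has in general no mean value point, but each real functional
    [Re (c * _)] has one, at a place that depends on [c]. *)
Lemma complex_mvt (F f : C -> C) (s1 s2 c : C) :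
  (forall t, 0 <= t <= 1 -> cderiv F (s1 + RtoC t * (s2 - s1))%C (f (s1 + RtoC t * (s2 - s1))%C)) ->
  exists t, 0 <= t <= 1 /\
    Re (c * (F s2 - F s1))%C = Re (c * (s2 - s1) * f (s1 + RtoC t * (s2 - s1)))%C.
Proof.
  intros H.
  destruct (MVT_gen (fun u : R => Re (c * F (s1 + RtoC u * (s2 - s1)))%C) 0 1
    (fun t => Re (c * (s2 - s1) * f (s1 + RtoC t * (s2 - s1)))%C)) as (t & Ht & E).
  - intros x Hx. rewrite Rmin_left, Rmax_right in Hx by lra.
    apply is_derive_segment, H. lra.
  - intros x Hx. rewrite Rmin_left, Rmax_right in Hx by lra.
    apply derivable_continuous_pt. eexists. apply is_derive_Reals.
    apply is_derive_segment, H. lra.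
  - rewrite Rmin_left, Rmax_right in Ht by lra. exists t. split; [exact Ht|].
    rewrite Rminus_0_r, Rmult_1_r in E. rewrite <- E.
    replace (s1 + RtoC 1 * (s2 - s1))%C with s2 by ring.
    replace (s1 + RtoC 0 * (s2 - s1))%C with s1 by ring.
    destruct c, (F s2), (F s1). unfold Re. simpl. ring.
Qed.

(** Taking for [c] the conjugate of the increment [W] turns [Re (c * W)] into [Cmod W ^ 2]. *)
Lemma complex_mvt_ineq (F f : C -> C) (s1 s2 : C) :
  (forall t, 0 <= t <= 1 -> cderiv F (s1 + RtoC t * (s2 - s1))%C (f (s1 + RtoC t * (s2 - s1))%C)) ->
  exists t, 0 <= t <= 1 /\
    Cmod (F s2 - F s1)%C <= Cmod (s2 - s1)%C * Cmod (f (s1 + RtoC t * (s2 - s1)))%C.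
Proof.
  intros H. set (W := (F s2 - F s1)%C).
  destruct (complex_mvt F f s1 s2 (Cconj W) H) as (t & Ht & E). fold W in E.
  exists t. split; [exact Ht|].
  destruct (Req_dec (Cmod W) 0) as [Z|Z].
  { rewrite Z. apply Rmult_le_pos; apply Cmod_ge_0. }
  assert (Z' : 0 < Cmod W) by (pose proof (Cmod_ge_0 W); lra).
  apply Rmult_le_reg_l with (Cmod W); [lra|].
  replace (Cmod W * Cmod W) with (Re (Cconj W * W)%C).
  2:{ replace (Cmod W * Cmod W) with (Cmod W ^ 2) by ring. rewrite Cmod2_alt.
      destruct W. unfold Re, Im. simpl. ring. }
  rewrite E. eapply Rle_trans; [apply Re_le|].
  rewrite !Cmod_mult, Cmod_conj. lra.
Qed.

(** * Primitives on a half-plane *)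

Lemma continuous_lipschitz (g : R -> R) (t M del : R) : 0 < del ->
  (forall h, Rabs h < del -> Rabs (g (t + h) - g t) <= M * Rabs h) -> continuous g t.
Proof.
  intros Hd H. apply continuity_pt_filterlim. intros eps Heps.
  pose proof (Rabs_pos M).
  exists (Rmin del (eps / (Rabs M + 1))). split.
  { apply Rmin_pos; [lra|]. apply Rdiv_lt_0_compat; lra. }
  intros x (_ & Hx). simpl in *. unfold Rdist in *.
  pose proof (Rmin_l del (eps / (Rabs M + 1))).
  pose proof (Rmin_r del (eps / (Rabs M + 1))).
  specialize (H (x - t) ltac:(lra)). replace (t + (x - t)) with x in H by ring.
  pose proof (Rabs_pos (x - t)). pose proof (Rle_abs M).
  apply Rle_lt_trans with (Rabs M * Rabs (x - t)); [nra|].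
  apply Rle_lt_trans with (Rabs M * (eps / (Rabs M + 1))); [nra|].
  apply Rlt_le_trans with ((Rabs M + 1) * (eps / (Rabs M + 1))).
  - apply Rmult_lt_compat_r; [apply Rdiv_lt_0_compat; lra|lra].
  - apply Req_le. field. lra.
Qed.

Lemma Re_scal_gt (s : C) (t : R) : -1 < Re s -> 0 <= t <= 1 -> -1 < Re (RtoC t * s)%C.
Proof. intros H Ht. destruct s as [x y]. unfold Re in *. simpl in *. destruct (Rle_dec 0 x); nra. Qed.

Lemma Re_near_gt (z w : C) : Cmod w < Re z + 1 -> -1 < Re (z + w)%C.
Proof.
  intros H. pose proof (re_le_Cmod w) as H1. apply Rabs_le_between in H1.
  destruct z, w. unfold Re in *. simpl in *. lra.
Qed.

(* [c w f (s)] is the integral over [0, 1] of the derivative of [t |-> c w t f (t s)], [w = v - s]. *)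
Lemma segment_integral_quad (f f1 : C -> C) (A : R) (c s v : C) : 0 <= A ->
  (forall s v, -1 < Re s -> -1 < Re v ->
    Cmod (f v - f s - f1 s * (v - s))%C <= A * Cmod (v - s)%C ^ 2) ->
  (forall s v, -1 < Re s -> -1 < Re v -> Cmod (f1 v - f1 s)%C <= A * Cmod (v - s)%C) ->
  (forall s, -1 < Re s -> Cmod (f1 s) <= A) ->
  -1 < Re s -> -1 < Re v ->
  Rabs (RInt (fun t => Re (c * (v * f (RtoC t * v)%C))%C) 0 1
        - RInt (fun t => Re (c * (s * f (RtoC t * s)%C))%C) 0 1
        - Re (c * (f s * (v - s)))%C)
  <= Cmod c * (A * Cmod v + A) * Cmod (v - s)%C ^ 2.
Proof.
  intros HA H1 H2 H3 Hs Hv.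
  assert (Hc : forall z, -1 < Re z -> cderiv f z (f1 z)).
  { intros z Hz. exists A, (Re z + 1). repeat split; [lra|lra|]. intros w Hw.
    pose proof (Re_near_gt z w Hw) as Hzw.
    specialize (H1 z (z + w)%C Hz Hzw). replace (z + w - z)%C with w in H1 by ring. exact H1. }
  assert (Hder : forall b u t, -1 < Re u -> 0 <= t <= 1 ->
    is_derive (fun t : R => Re (b * f (RtoC t * u))%C) t (Re (b * u * f1 (RtoC t * u))%C)).
  { intros b u t Hu Ht.
    apply is_derive_ext with (fun t : R => Re (b * f (RtoC 0 + RtoC t * u))%C).
    { intros x. do 2 f_equal. f_equal. ring. }
    replace (RtoC t * u)%C with (RtoC 0 + RtoC t * u)%C at 1 by ring.
    apply is_derive_segment. replace (RtoC 0 + RtoC t * u)%C with (RtoC t * u)%C by ring.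
    apply Hc, Re_scal_gt; assumption. }
  assert (Hcont : forall b u t, -1 < Re u -> 0 <= t <= 1 ->
    continuous (fun t : R => Re (b * f (RtoC t * u))%C) t).
  { intros b u t Hu Ht. apply (ex_derive_continuous (V := R_NormedModule)).
    eexists. apply Hder; assumption. }
  assert (Hcont1 : forall b u t, -1 < Re u -> 0 <= t <= 1 ->
    continuous (fun t : R => Re (b * f1 (RtoC t * u))%C) t).
  { intros b u t Hu Ht. pose proof (Re_scal_gt u t Hu Ht) as Hr. pose proof (Cmod_ge_0 u).
    pose proof (Cmod_ge_0 b).
    apply continuous_lipschitz with (M := Cmod b * (A * Cmod u))
      (del := (Re (RtoC t * u)%C + 1) / (Cmod u + 1)).
    { apply Rdiv_lt_0_compat; lra. }
    intros h Hh.
    assert (Hw : Cmod (RtoC h * u)%C < Re (RtoC t * u)%C + 1).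
    { rewrite Cmod_mult, Cmod_R. pose proof (Rabs_pos h).
      apply Rle_lt_trans with (Rabs h * (Cmod u + 1)); [nra|].
      apply Rlt_le_trans with ((Re (RtoC t * u)%C + 1) / (Cmod u + 1) * (Cmod u + 1)).
      - apply Rmult_lt_compat_r; lra.
      - apply Req_le. field. lra. }
    apply Re_near_gt in Hw. replace (RtoC t * u + RtoC h * u)%C with (RtoC (t + h) * u)%C in Hw
      by (rewrite RtoC_plus; ring).
    specialize (H2 _ _ Hr Hw).
    replace (RtoC (t + h) * u - RtoC t * u)%C with (RtoC h * u)%C in H2
      by (rewrite RtoC_plus; ring).
    rewrite Cmod_mult, Cmod_R in H2.
    set (p := f1 (RtoC (t + h) * u)%C) in *. set (q := f1 (RtoC t * u)%C) in *.
    replace (Re (b * p)%C - Re (b * q)%C) with (Re (b * (p - q))%C)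
      by (destruct b, p, q; unfold Re; simpl; ring).
    eapply Rle_trans; [apply re_le_Cmod|]. rewrite Cmod_mult.
    rewrite Rmult_assoc. apply Rmult_le_compat_l; [assumption|]. lra. }
  set (w := (v - s)%C).
  assert (I1 : forall b u, -1 < Re u ->
    is_RInt (fun t => Re (b * f (RtoC t * u))%C) 0 1
            (RInt (fun t => Re (b * f (RtoC t * u))%C) 0 1)).
  { intros b u Hu. apply (RInt_correct (V := R_CompleteNormedModule)).
    apply (ex_RInt_continuous (V := R_CompleteNormedModule)). intros t Ht.
    rewrite Rmin_left, Rmax_right in Ht by lra. apply Hcont; assumption. }
  assert (E1 : forall u, -1 < Re u -> RInt (fun t => Re (c * (u * f (RtoC t * u)%C))%C) 0 1
    = RInt (fun t => Re ((c * u) * f (RtoC t * u)%C)%C) 0 1).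
  { intros u _. apply RInt_ext. intros x _. f_equal. ring. }
  rewrite (E1 s Hs), (E1 v Hv).
  assert (I2 : is_RInt (fun t => Re (c * w * f (RtoC t * s))%C
      + t * Re (c * w * s * f1 (RtoC t * s))%C) 0 1 (Re (c * (f s * w))%C)).
  { replace (Re (c * (f s * w))%C) with
      (minus (1 * Re (c * w * f (RtoC 1 * s))%C) (0 * Re (c * w * f (RtoC 0 * s))%C)).
    2:{ change (1 * Re (c * w * f (RtoC 1 * s))%C + - (0 * Re (c * w * f (RtoC 0 * s))%C)
              = Re (c * (f s * w))%C).
        replace (RtoC 1 * s)%C with s by ring.
        rewrite Rmult_1_l, Rmult_0_l, Ropp_0, Rplus_0_r. f_equal. ring. }
    apply (is_RInt_derive (V := R_CompleteNormedModule)
      (fun t => t * Re (c * w * f (RtoC t * s))%C)).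
    - intros t Ht. rewrite Rmin_left, Rmax_right in Ht by lra.
      rewrite <- (Rmult_1_l (Re (c * w * f (RtoC t * s))%C)).
      apply is_derive_Reals.
      apply (derivable_pt_lim_mult (fun t => t) (fun t => Re (c * w * f (RtoC t * s))%C)).
      + apply derivable_pt_lim_id.
      + apply is_derive_Reals, Hder; assumption.
    - intros t Ht. rewrite Rmin_left, Rmax_right in Ht by lra.
      apply (continuous_plus (V := R_NormedModule)); [apply Hcont; assumption|].
      apply (continuous_mult (K := R_AbsRing)); [apply continuous_id|].
      apply Hcont1; assumption. }
  pose proof (is_RInt_minus _ _ _ _ _ _ (is_RInt_minus _ _ _ _ _ _ (I1 (c * v)%C v Hv)
    (I1 (c * s)%C s Hs)) I2) as I3.
  match type of I3 with is_RInt ?g _ _ ?l => set (G := g) in I3; set (l0 := l) in I3 end.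
  assert (E2 : RInt G 0 1 = l0) by (apply is_RInt_unique; exact I3).
  match goal with |- Rabs ?x <= _ => replace x with (RInt G 0 1) by exact E2 end.
  replace (Cmod c * (A * Cmod v + A) * Cmod w ^ 2)
    with ((1 - 0) * (Cmod c * (A * Cmod v + A) * Cmod w ^ 2)) by ring.
  apply abs_RInt_le_const; [lra|eexists; exact I3|].
  intros t Ht. change (G t) with (Re (c * v * f (RtoC t * v))%C + - Re (c * s * f (RtoC t * s))%C +
     - (Re (c * w * f (RtoC t * s))%C + t * Re (c * w * s * f1 (RtoC t * s))%C)).
  pose proof (Re_scal_gt s t Hs Ht) as Rs. pose proof (Re_scal_gt v t Hv Ht) as Rv.
  (* Up to the factor [c], the integrand is [v] times the Taylor remainder of [f] between [t s] and
     [t v], plus [t w ^ 2 f1 (t s)]. Both are quadratic in [w] and account for the summands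
     [A * Cmod v] and [A] of the bound. *)
  replace (Re (c * v * f (RtoC t * v))%C + - Re (c * s * f (RtoC t * s))%C +
     - (Re (c * w * f (RtoC t * s))%C + t * Re (c * w * s * f1 (RtoC t * s))%C))
    with (Re (c * (v * (f (RtoC t * v) - f (RtoC t * s) - f1 (RtoC t * s) * (RtoC t * v - RtoC t * s))
              + RtoC t * (w * w) * f1 (RtoC t * s)))%C).
  2:{ unfold w. generalize (f (RtoC t * v)%C) (f (RtoC t * s)%C) (f1 (RtoC t * s)%C).
      intros a b d. destruct a, b, d, c, v, s. unfold Re. simpl. ring. }
  eapply Rle_trans; [apply re_le_Cmod|]. rewrite Cmod_mult.
  rewrite !Rmult_assoc. apply Rmult_le_compat_l; [apply Cmod_ge_0|].
  eapply Rle_trans; [apply Cmod_triangle|]. rewrite !Cmod_mult, Cmod_R.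
  specialize (H1 _ _ Rs Rv). specialize (H3 _ Rs).
  replace (RtoC t * v - RtoC t * s)%C with (RtoC t * w)%C in * by (unfold w; ring).
  rewrite (Cmod_mult _ w), Cmod_R in H1.
  rewrite (Rabs_pos_eq t) in * by lra.
  pose proof (Cmod_ge_0 v). pose proof (Cmod_ge_0 w) as Hw0.
  rewrite Rmult_plus_distr_r. apply Rplus_le_compat.
  - rewrite (Rmult_comm A), Rmult_assoc. apply Rmult_le_compat_l; [assumption|].
    eapply Rle_trans; [exact H1|]. apply Rmult_le_compat_l; [assumption|].
    apply pow_incr. nra.
  - pose proof (Cmod_ge_0 (f1 (RtoC t * s)%C)). simpl. rewrite Rmult_1_r.
    apply Rle_trans with (1 * (Cmod w * Cmod w) * A); [|nra].
    apply Rmult_le_compat; [nra|assumption|nra|assumption].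
Qed.

(** The radial integral from 0 serves as primitive, the half-plane being star-shaped about 0. Its
    real and imaginary parts are the cases [c = 1] and [c = - Ci] of the previous estimate; their
    errors add up to the factor 2. *)
Lemma exists_primitive (f f1 : C -> C) (A : R) : 0 <= A ->
  (forall s v, -1 < Re s -> -1 < Re v ->
    Cmod (f v - f s - f1 s * (v - s))%C <= A * Cmod (v - s)%C ^ 2) ->
  (forall s v, -1 < Re s -> -1 < Re v -> Cmod (f1 v - f1 s)%C <= A * Cmod (v - s)%C) ->
  (forall s, -1 < Re s -> Cmod (f1 s) <= A) ->
  exists F : C -> C, forall s, -1 < Re s -> cderiv F s (f s).
Proof.
  intros HA H1 H2 H3.
  exists (fun s => (RInt (fun t => Re (1 * (s * f (RtoC t * s)%C))%C) 0 1,
                    RInt (fun t => Re (- Ci * (s * f (RtoC t * s)%C))%C) 0 1)).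
  intros s Hs. pose proof (Cmod_ge_0 s).
  exists (2 * (A * (Cmod s + 1) + A)), (Rmin 1 (Re s + 1)).
  split; [nra|]. split; [apply Rmin_pos; lra|]. intros w Hw.
  pose proof (Rmin_l 1 (Re s + 1)). pose proof (Rmin_r 1 (Re s + 1)).
  assert (Hv : -1 < Re (s + w)%C) by (apply Re_near_gt; lra).
  pose proof (segment_integral_quad f f1 A 1%C s (s + w)%C HA H1 H2 H3 Hs Hv) as K1.
  pose proof (segment_integral_quad f f1 A (- Ci)%C s (s + w)%C HA H1 H2 H3 Hs Hv) as K2.
  replace (s + w - s)%C with w in * by ring.
  rewrite Cmod_1 in K1. rewrite Cmod_opp, Cmod_Ci in K2.
  assert (Cmod (s + w)%C <= Cmod s + 1).
  { eapply Rle_trans; [apply Cmod_triangle|]. lra. }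
  assert (B : 1 * (A * Cmod (s + w)%C + A) * Cmod w ^ 2 <= (A * (Cmod s + 1) + A) * Cmod w ^ 2).
  { apply Rmult_le_compat_r; [apply pow2_ge_0|]. nra. }
  eapply Rle_trans; [apply Cmod_le_sum|].
  apply Rle_trans with ((A * (Cmod s + 1) + A) * Cmod w ^ 2 + (A * (Cmod s + 1) + A) * Cmod w ^ 2);
    [|lra].
  apply Rplus_le_compat.
  - eapply Rle_trans; [|exact B]. eapply Rle_trans; [|exact K1]. apply Req_le. f_equal.
    generalize (f s). intros a. destruct a, w. unfold Re. simpl. ring.
  - eapply Rle_trans; [|exact B]. eapply Rle_trans; [|exact K2]. apply Req_le. f_equal.
    generalize (f s). intros a. destruct a, w. unfold Re, Im. simpl. ring.
Qed.

(** * Complex Stieltjes series *)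

Lemma is_series_le (a b : nat -> R) (la lb : R) :
  (forall n, a n <= b n) -> is_series a la -> is_series b lb -> la <= lb.
Proof.
  intros H Ha Hb.
  apply (is_lim_seq_le (sum_n a) (sum_n b) la lb); [|exact Ha|exact Hb].
  intros n. apply sum_n_m_le, H.
Qed.

Lemma is_series_Rmult (c : R) (a : nat -> R) (l : R) :
  is_series a l -> is_series (fun n => c * a n) (c * l).
Proof. intros H. exact (is_series_scal (K := R_AbsRing) (V := R_NormedModule) c a l H). Qed.

Lemma is_series_half (M : R) : is_series (fun n => M * (1 / 2) ^ n) (2 * M).
Proof.
  replace (2 * M) with (M * / (1 - 1 / 2)) by field.
  apply is_series_Rmult. apply is_series_geom. rewrite Rabs_pos_eq; lra.
Qed.

(** Convergence is coordinatewise, so that the comparison lemmas for real series apply directly. *)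
Definition is_Cseries (u : nat -> C) (l : C) : Prop :=
  is_series (fun n => Re (u n)) (Re l) /\ is_series (fun n => Im (u n)) (Im l).

Definition Cseries (u : nat -> C) : C := (Series (fun n => Re (u n)), Series (fun n => Im (u n))).

Lemma csum_plus u v l m : is_Cseries u l -> is_Cseries v m -> is_Cseries (fun n => u n + v n)%C (l + m)%C.
Proof. intros (H1 & H2) (H3 & H4). split; apply (is_series_plus (V := R_NormedModule)); assumption. Qed.

Lemma csum_scal c u l : is_Cseries u l -> is_Cseries (fun n => c * u n)%C (c * l)%C.
Proof.
  intros (H1 & H2). destruct c as [x y]. split; unfold Re, Im; simpl.
  - apply (is_series_minus (V := R_NormedModule)); apply is_series_Rmult; assumption.
  - apply (is_series_plus (V := R_NormedModule)); apply is_series_Rmult; assumption.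
Qed.

(** Multiplying the series by the conjugate of its sum makes the sum real and nonnegative, which
    reduces the triangle inequality to a termwise comparison of real series. *)
Lemma csum_bound u l b B : (forall n, Cmod (u n) <= b n) -> is_Cseries u l -> is_series b B -> Cmod l <= B.
Proof.
  intros H Hu Hb.
  destruct (Req_dec (Cmod l) 0) as [Z|Z].
  { rewrite Z. replace 0 with (0 * B) by ring.
    apply (is_series_le (fun n => 0 * b n) b (0 * B) B); [|apply is_series_Rmult, Hb|exact Hb].
    intros n. rewrite Rmult_0_l. eapply Rle_trans; [apply Cmod_ge_0|apply H]. }
  assert (Z' : 0 < Cmod l) by (pose proof (Cmod_ge_0 l); lra).
  apply Rmult_le_reg_l with (Cmod l); [lra|].
  destruct (csum_scal (Cconj l) u l Hu) as (H1 & _).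
  replace (Cmod l * Cmod l) with (Re (Cconj l * l)%C).
  2:{ replace (Cmod l * Cmod l) with (Cmod l ^ 2) by ring. rewrite Cmod2_alt.
      destruct l. unfold Re, Im. simpl. ring. }
  apply (is_series_le _ _ _ _) with (2 := H1) (3 := is_series_Rmult (Cmod l) _ _ Hb).
  intros n. eapply Rle_trans; [apply Re_le|]. rewrite Cmod_mult, Cmod_conj.
  apply Rmult_le_compat_l; [lra|apply H].
Qed.

Lemma Cseries_csum u b : (forall n, Cmod (u n) <= b n) -> ex_series b -> is_Cseries u (Cseries u).
Proof.
  intros H Hb. split; simpl; apply Series_correct;
    apply (ex_series_le (V := R_CompleteNormedModule)) with b; auto; intros n.
  - eapply Rle_trans; [apply re_le_Cmod|apply H].
  - eapply Rle_trans; [apply im_le_Cmod|apply H].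
Qed.

Lemma Cmod_plus_R_ge (s : C) (x : R) : Re s + x <= Cmod (s + RtoC x)%C.
Proof.
  eapply Rle_trans; [|apply Re_le]. destruct s. unfold Re. simpl. lra.
Qed.

Definition stieltjes (d R : nat -> R) (s : C) : C := Cseries (fun n => RtoC (d n) / (s + RtoC (R n)))%C.
Definition stieltjes1 (d R : nat -> R) (s : C) : C :=
  (- Cseries (fun n => RtoC (d n) / ((s + RtoC (R n)) * (s + RtoC (R n)))))%C.

Section Stieltjes.
Variables d R : nat -> R.
Hypothesis HR : forall n, 2 <= R n.
Hypothesis Hd : forall n, 0 <= d n <= (1 / 2) ^ n * R n.

Lemma stj_ge (s : C) n : -1 < Re s -> R n / 2 <= Cmod (s + RtoC (R n))%C.
Proof. intros Hs. pose proof (Cmod_plus_R_ge s (R n)). specialize (HR n). lra. Qed.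

Lemma stj_neq (s : C) n : -1 < Re s -> (s + RtoC (R n))%C <> 0%C.
Proof. intros Hs. apply Cmod_gt_0. pose proof (stj_ge s n Hs). specialize (HR n). lra. Qed.

Lemma stj_inv_le (s : C) n : -1 < Re s -> / Cmod (s + RtoC (R n))%C <= 1.
Proof.
  intros Hs. pose proof (stj_ge s n Hs). specialize (HR n).
  rewrite <- Rinv_1. apply Rinv_le_contravar; lra.
Qed.

(** [d n] is at most [(1 / 2) ^ n * R n], and [R n] at most twice the denominator. The majorant does
    not involve [d] or [R], so the constants 4 and 8 below hold for all admissible sequences at
    once. *)
Lemma stj_term1 (s : C) n : -1 < Re s -> d n * / Cmod (s + RtoC (R n))%C <= 2 * (1 / 2) ^ n.
Proof.
  intros Hs. pose proof (stj_ge s n Hs). specialize (HR n). specialize (Hd n).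
  apply Rmult_le_reg_r with (Cmod (s + RtoC (R n))%C); [lra|].
  rewrite Rmult_assoc, Rinv_l, Rmult_1_r by lra.
  assert (0 < (1 / 2) ^ n) by (apply pow_lt; lra). nra.
Qed.

Lemma stj_inv_pos (s : C) n : -1 < Re s -> 0 < / Cmod (s + RtoC (R n))%C.
Proof.
  intros Hs. apply Rinv_0_lt_compat. pose proof (stj_ge s n Hs). specialize (HR n). lra.
Qed.

Lemma stj_summable (s : C) : -1 < Re s ->
  is_Cseries (fun n => RtoC (d n) / (s + RtoC (R n)))%C (stieltjes d R s).
Proof.
  intros Hs. apply Cseries_csum with (fun n => 2 * (1 / 2) ^ n); [|eexists; apply is_series_half].
  intros n. rewrite Cmod_div by (apply stj_neq, Hs). rewrite Cmod_R, Rabs_pos_eq by apply Hd.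
  apply stj_term1, Hs.
Qed.

Lemma stj1_term (s : C) n : -1 < Re s ->
  Cmod (RtoC (d n) / ((s + RtoC (R n)) * (s + RtoC (R n))))%C <= 2 * (1 / 2) ^ n.
Proof.
  intros Hs. pose proof (stj_neq s n Hs). rewrite Cmod_div by (apply Cmult_neq_0; assumption).
  rewrite Cmod_R, Rabs_pos_eq by apply Hd. rewrite Cmod_mult. unfold Rdiv. rewrite Rinv_mult.
  pose proof (stj_term1 s n Hs). pose proof (stj_inv_le s n Hs). pose proof (stj_inv_pos s n Hs).
  rewrite <- Rmult_assoc. specialize (Hd n).
  set (q := / Cmod (s + RtoC (R n))%C) in *.
  assert (0 <= d n * q) by (apply Rmult_le_pos; lra). nra.
Qed.

Lemma stj1_summable (s : C) : -1 < Re s ->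
  is_Cseries (fun n => - (1) * (RtoC (d n) / ((s + RtoC (R n)) * (s + RtoC (R n)))))%C (stieltjes1 d R s).
Proof.
  intros Hs. unfold stieltjes1. match goal with |- is_Cseries _ (- ?x)%C =>
    replace (- x)%C with (- (1) * x)%C by ring end.
  apply csum_scal.
  apply Cseries_csum with (fun n => 2 * (1 / 2) ^ n); [|eexists; apply is_series_half].
  intros n. apply stj1_term, Hs.
Qed.

Lemma stj_bound (s : C) : -1 < Re s -> Cmod (stieltjes d R s) <= 4.
Proof.
  intros Hs. replace 4 with (2 * 2) by ring.
  refine (csum_bound _ _ _ _ _ (stj_summable s Hs) (is_series_half 2)).
  intros n. rewrite Cmod_div by (apply stj_neq, Hs). rewrite Cmod_R, Rabs_pos_eq by apply Hd.
  apply stj_term1, Hs.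
Qed.

Lemma stj1_bound (s : C) : -1 < Re s -> Cmod (stieltjes1 d R s) <= 4.
Proof.
  intros Hs. replace 4 with (2 * 2) by ring.
  refine (csum_bound _ _ _ _ _ (stj1_summable s Hs) (is_series_half 2)).
  intros n. rewrite Cmod_mult, Cmod_opp, Cmod_1, Rmult_1_l. apply stj1_term, Hs.
Qed.

Lemma stj_lip (s v : C) : -1 < Re s -> -1 < Re v ->
  Cmod (stieltjes d R v - stieltjes d R s)%C <= 4 * Cmod (v - s)%C.
Proof.
  intros Hs Hv.
  pose proof (csum_plus _ _ _ _ (stj_summable v Hv) (csum_scal (- (1))%C _ _ (stj_summable s Hs))) as H.
  replace (stieltjes d R v - stieltjes d R s)%C with (stieltjes d R v + - (1) * stieltjes d R s)%C by ring.
  replace (4 * Cmod (v - s)%C) with (2 * (2 * Cmod (v - s)%C)) by ring.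
  refine (csum_bound _ _ _ _ _ H (is_series_half _)). intros n. cbv beta.
  pose proof (stj_neq s n Hs) as Ns. pose proof (stj_neq v n Hv) as Nv.
  replace (RtoC (d n) / (v + RtoC (R n)) + - (1) * (RtoC (d n) / (s + RtoC (R n))))%C
    with (- (RtoC (d n) * (v - s) * / (v + RtoC (R n)) * / (s + RtoC (R n))))%C by (field; auto).
  rewrite Cmod_opp, !Cmod_mult, !Cmod_inv by assumption.
  rewrite Cmod_R, Rabs_pos_eq by apply Hd.
  pose proof (stj_term1 s n Hs). pose proof (stj_inv_pos s n Hs).
  pose proof (stj_inv_le v n Hv). pose proof (stj_inv_pos v n Hv).
  specialize (Hd n). pose proof (Cmod_ge_0 (v - s)%C).
  set (a := / Cmod (v + RtoC (R n))%C) in *. set (b := / Cmod (s + RtoC (R n))%C) in *.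
  replace (d n * Cmod (v - s)%C * a * b) with (Cmod (v - s)%C * (a * (d n * b))) by ring.
  replace (2 * Cmod (v - s)%C * (1 / 2) ^ n) with (Cmod (v - s)%C * (2 * (1 / 2) ^ n)) by ring.
  apply Rmult_le_compat_l; [assumption|].
  assert (0 <= d n * b) by (apply Rmult_le_pos; lra). nra.
Qed.

(** The second-order remainder of one term is explicit: [1/(v+R) - 1/(s+R) + (v-s)/(s+R)^2 = (v-s)^2
    / ((v+R) (s+R)^2)]. Differentiability of the sum thus follows by adding bounds, without
    interchanging limits. *)
Lemma stj_quad (s v : C) : -1 < Re s -> -1 < Re v ->
  Cmod (stieltjes d R v - stieltjes d R s - stieltjes1 d R s * (v - s))%C <= 4 * Cmod (v - s)%C ^ 2.
Proof.
  intros Hs Hv.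
  pose proof (csum_plus _ _ _ _ (csum_plus _ _ _ _ (stj_summable v Hv)
    (csum_scal (- (1))%C _ _ (stj_summable s Hs)))
    (csum_scal (- (v - s))%C _ _ (stj1_summable s Hs))) as H.
  replace (stieltjes d R v - stieltjes d R s - stieltjes1 d R s * (v - s))%C
    with (stieltjes d R v + - (1) * stieltjes d R s + - (v - s) * stieltjes1 d R s)%C by ring.
  replace (4 * Cmod (v - s)%C ^ 2) with (2 * (2 * Cmod (v - s)%C ^ 2)) by ring.
  refine (csum_bound _ _ _ _ _ H (is_series_half _)). intros n. cbv beta.
  pose proof (stj_neq s n Hs) as Ns. pose proof (stj_neq v n Hv) as Nv.
  replace (RtoC (d n) / (v + RtoC (R n)) + - (1) * (RtoC (d n) / (s + RtoC (R n)))
     + - (v - s) * (- (1) * (RtoC (d n) / ((s + RtoC (R n)) * (s + RtoC (R n))))))%C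
    with (RtoC (d n) * ((v - s) * (v - s)) * / (v + RtoC (R n)) * / (s + RtoC (R n))
      * / (s + RtoC (R n)))%C by (field; auto).
  rewrite !Cmod_mult, !Cmod_inv by assumption.
  rewrite Cmod_R, Rabs_pos_eq by apply Hd.
  pose proof (stj_term1 s n Hs). pose proof (stj_inv_pos s n Hs). pose proof (stj_inv_le s n Hs).
  pose proof (stj_inv_le v n Hv). pose proof (stj_inv_pos v n Hv).
  specialize (Hd n). pose proof (Cmod_ge_0 (v - s)%C).
  set (a := / Cmod (v + RtoC (R n))%C) in *. set (b := / Cmod (s + RtoC (R n))%C) in *.
  set (W := Cmod (v - s)%C) in *.
  replace (d n * (W * W) * a * b * b) with (W ^ 2 * (a * b * (d n * b))) by ring.
  replace (2 * W ^ 2 * (1 / 2) ^ n) with (W ^ 2 * (2 * (1 / 2) ^ n)) by ring.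
  apply Rmult_le_compat_l; [apply pow2_ge_0|].
  assert (0 <= d n * b) by (apply Rmult_le_pos; lra).
  assert (0 <= a * b <= 1) by nra. nra.
Qed.

Lemma stj1_lip (s v : C) : -1 < Re s -> -1 < Re v ->
  Cmod (stieltjes1 d R v - stieltjes1 d R s)%C <= 8 * Cmod (v - s)%C.
Proof.
  intros Hs Hv.
  pose proof (csum_plus _ _ _ _ (stj1_summable v Hv) (csum_scal (- (1))%C _ _ (stj1_summable s Hs))) as H.
  replace (stieltjes1 d R v - stieltjes1 d R s)%C with (stieltjes1 d R v + - (1) * stieltjes1 d R s)%C by ring.
  replace (8 * Cmod (v - s)%C) with (2 * (4 * Cmod (v - s)%C)) by ring.
  refine (csum_bound _ _ _ _ _ H (is_series_half _)). intros n. cbv beta.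
  pose proof (stj_neq s n Hs) as Ns. pose proof (stj_neq v n Hv) as Nv.
  replace (- (1) * (RtoC (d n) / ((v + RtoC (R n)) * (v + RtoC (R n)))) +
      - (1) * (- (1) * (RtoC (d n) / ((s + RtoC (R n)) * (s + RtoC (R n))))))%C
    with ((v - s) * (RtoC (d n) * / (v + RtoC (R n)) * / (s + RtoC (R n)) * / (v + RtoC (R n))
       + RtoC (d n) * / (v + RtoC (R n)) * / (s + RtoC (R n)) * / (s + RtoC (R n))))%C by (field; auto).
  rewrite Cmod_mult.
  replace (4 * Cmod (v - s)%C * (1 / 2) ^ n) with (Cmod (v - s)%C * (4 * (1 / 2) ^ n)) by ring.
  apply Rmult_le_compat_l; [apply Cmod_ge_0|].
  eapply Rle_trans; [apply Cmod_triangle|].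
  rewrite !Cmod_mult, !Cmod_inv by assumption.
  rewrite Cmod_R, Rabs_pos_eq by apply Hd.
  pose proof (stj_term1 s n Hs). pose proof (stj_inv_pos s n Hs). pose proof (stj_inv_le s n Hs).
  pose proof (stj_inv_le v n Hv). pose proof (stj_inv_pos v n Hv).
  specialize (Hd n). pose proof (Cmod_ge_0 (v - s)%C).
  set (a := / Cmod (v + RtoC (R n))%C) in *. set (b := / Cmod (s + RtoC (R n))%C) in *.
  replace (d n * a * b * a + d n * a * b * b) with ((a * a + a * b) * (d n * b)) by ring.
  assert (0 <= d n * b) by (apply Rmult_le_pos; lra).
  assert (0 <= a * a + a * b <= 2) by nra. nra.
Qed.

Lemma stj_cderiv (s : C) : -1 < Re s -> cderiv (stieltjes d R) s (stieltjes1 d R s).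
Proof.
  intros Hs. exists 4, (Re s + 1). repeat split; try lra. intros w Hw.
  pose proof (stj_quad s (s + w)%C Hs (Re_near_gt s w Hw)) as H.
  replace (s + w - s)%C with w in H by ring. exact H.
Qed.

End Stieltjes.

(** * The vector field f *)

Definition wgt (r : nat -> R) (n : nat) : R := (1 / 2) ^ n * r n.
Definition pole (r : nat -> R) (n : nat) : R := r n ^ 2.
Definition pfun (r : nat -> R) : C -> C := stieltjes (wgt r) (pole r).
Definition pfun1 (r : nat -> R) : C -> C := stieltjes1 (wgt r) (pole r).
(* The factor 1/3 makes the vertical sections of the image of a primitive about [3 pi] long, halfway
   between the lengths [2 pi] (surjectivity) and [4 pi] (valence 2). *)
Definition field_F (r : nat -> R) (s : C) : C := (- RtoC (1 / 3) * (pfun r s * pfun r s) + Ci * pfun r s)%C.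

Lemma pow_half_pos n : 0 < (1 / 2) ^ n.
Proof. apply pow_lt. lra. Qed.

Lemma Re_term (d R0 : R) (s : C) : 0 < Re s + R0 ->
  Re (RtoC d / (s + RtoC R0))%C = d * (Re s + R0) / ((Re s + R0) ^ 2 + Im s ^ 2).
Proof.
  destruct s as [x y]. unfold Re, Im. simpl. intros H. field.
  repeat split; nra.
Qed.

Lemma Im_term (d R0 : R) (s : C) : 0 < Re s + R0 ->
  Im (RtoC d / (s + RtoC R0))%C = - Im s * (d / ((Re s + R0) ^ 2 + Im s ^ 2)).
Proof.
  destruct s as [x y]. unfold Re, Im. simpl. intros H. field.
  repeat split; nra.
Qed.

Lemma Cmod_term1 (d R0 : R) (s : C) : 0 < Re s + R0 -> 0 <= d ->
  Cmod (RtoC d / ((s + RtoC R0) * (s + RtoC R0)))%C = d / ((Re s + R0) ^ 2 + Im s ^ 2).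
Proof.
  intros H Hd. assert (N : (s + RtoC R0)%C <> 0%C).
  { apply Cmod_gt_0. pose proof (Cmod_plus_R_ge s R0). lra. }
  rewrite Cmod_div by (apply Cmult_neq_0; assumption).
  rewrite Cmod_R, Rabs_pos_eq, Cmod_mult by assumption.
  f_equal. replace (Cmod (s + RtoC R0)%C * Cmod (s + RtoC R0)%C) with (Cmod (s + RtoC R0)%C ^ 2) by ring.
  rewrite Cmod2_alt. destruct s. unfold Re, Im. simpl. ring.
Qed.

Section Field.
Variable r : nat -> R.
Hypothesis r0 : r 0%nat = 10000.
Hypothesis rge : forall n, 10000 <= r n.

Lemma pole_ge n : 100000000 <= pole r n.
Proof. unfold pole. specialize (rge n). nra. Qed.

Lemma pole_ge2 n : 2 <= pole r n.
Proof. pose proof (pole_ge n). lra. Qed.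

Lemma wgt_pos n : 0 < wgt r n.
Proof. unfold wgt. apply Rmult_lt_0_compat; [apply pow_half_pos|]. specialize (rge n). lra. Qed.

Lemma wgt_bound n : 0 <= wgt r n <= (1 / 2) ^ n * pole r n.
Proof.
  split; [left; apply wgt_pos|]. unfold wgt, pole.
  apply Rmult_le_compat_l; [left; apply pow_half_pos|]. specialize (rge n). nra.
Qed.

Lemma P_series (s : C) : 0 <= Re s ->
  is_series (fun n => wgt r n * (Re s + pole r n) / ((Re s + pole r n) ^ 2 + Im s ^ 2)) (Re (pfun r s)).
Proof.
  intros Hs. destruct (stj_summable _ _ pole_ge2 wgt_bound s) as (H & _); [lra|].
  eapply is_series_ext; [|exact H]. intros n. cbv beta. apply Re_term.
  pose proof (pole_ge n). lra.
Qed.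

Lemma den_pos (s : C) n : 0 <= Re s -> 0 < (Re s + pole r n) ^ 2 + Im s ^ 2.
Proof. intros Hs. pose proof (pole_ge n). nra. Qed.

(** One positive series [Q] controls both defects of [p]: its failure to be real, which is [Q] times
    the height [Im s], and its derivative. *)
Lemma Q_series (s : C) : 0 <= Re s ->
  exists Q, is_series (fun n => wgt r n / ((Re s + pole r n) ^ 2 + Im s ^ 2)) Q /\
    Im (pfun r s) = - Im s * Q /\ Cmod (pfun1 r s) <= Q.
Proof.
  intros Hs.
  assert (EX : ex_series (fun n => wgt r n / ((Re s + pole r n) ^ 2 + Im s ^ 2))).
  { apply (ex_series_le (V := R_CompleteNormedModule)) with (fun n => 2 * (1 / 2) ^ n);
      [|eexists; apply is_series_half]. intros n.
    rewrite <- (Cmod_term1 (wgt r n) (pole r n) s);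
      [|pose proof (pole_ge n); lra|apply wgt_bound].
    eapply Rle_trans; [|apply (stj1_term _ _ pole_ge2 wgt_bound s n); lra].
    apply Req_le. apply Rabs_pos_eq. apply Cmod_ge_0. }
  destruct EX as (Q & HQ). exists Q. split; [exact HQ|]. split.
  - destruct (stj_summable _ _ pole_ge2 wgt_bound s) as (_ & H); [lra|].
    unfold pfun. rewrite <- (is_series_unique _ _ H).
    apply is_series_unique. eapply is_series_ext; [|apply is_series_Rmult, HQ].
    intros n. cbv beta. symmetry. apply Im_term. pose proof (pole_ge n). lra.
  - refine (csum_bound _ _ _ _ _ (stj1_summable _ _ pole_ge2 wgt_bound s _) HQ); [|lra].
    intros n. rewrite Cmod_mult, Cmod_opp, Cmod_1, Rmult_1_l, Cmod_term1;
      [lra|pose proof (pole_ge n); lra|apply wgt_bound].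
Qed.

Lemma is_series_ge_term (a : nat -> R) (l : R) (n : nat) : (forall k, 0 <= a k) -> is_series a l -> a n <= l.
Proof.
  intros Ha H.
  apply (is_lim_seq_le_loc (fun _ => a n) (sum_n a) (a n) l).
  - exists n. intros m Hm. induction Hm.
    + destruct n; [rewrite sum_O; lra|]. rewrite sum_Sn. unfold plus; simpl.
      assert (0 <= sum_n a n); [|lra].
      clear -Ha. induction n; [rewrite sum_O; apply Ha|]. rewrite sum_Sn. unfold plus; simpl.
      specialize (Ha (S n)). lra.
    + rewrite sum_Sn. unfold plus; simpl. specialize (Ha (S m)). lra.
  - apply is_lim_seq_const.
  - exact H.
Qed.

(** All terms are positive, so [P] dominates each of them. The factor 99/100 absorbs [Im s ^ 2 <= 4]
    against the squared distance to the pole. *)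
Lemma P_ge_term (s : C) n : 0 <= Re s -> Rabs (Im s) <= 2 ->
  (99 / 100) * wgt r n / (Re s + pole r n) <= Re (pfun r s).
Proof.
  intros Hs Ht. pose proof (P_series s Hs) as H.
  eapply Rle_trans; [|apply (is_series_ge_term _ _ n) with (2 := H)].
  - pose proof (pole_ge n). pose proof (wgt_pos n). pose proof (den_pos s n Hs).
    assert (Im s ^ 2 <= 4).
    { rewrite <- pow2_abs. pose proof (Rabs_pos (Im s)). nra. }
    apply Rmult_le_reg_r with (Re s + pole r n); [lra|].
    apply Rmult_le_reg_r with ((Re s + pole r n) ^ 2 + Im s ^ 2); [assumption|].
    replace ((99 / 100) * wgt r n / (Re s + pole r n) * (Re s + pole r n) * ((Re s + pole r n) ^ 2 + Im s ^ 2))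
      with (wgt r n * ((99 / 100) * ((Re s + pole r n) ^ 2 + Im s ^ 2))) by (field; lra).
    replace (wgt r n * (Re s + pole r n) / ((Re s + pole r n) ^ 2 + Im s ^ 2) * (Re s + pole r n) *
      ((Re s + pole r n) ^ 2 + Im s ^ 2)) with (wgt r n * (Re s + pole r n) ^ 2) by (field; lra).
    apply Rmult_le_compat_l; [lra|].
    assert (100000000 <= (Re s + pole r n) ^ 2) by nra. lra.
  - intros k. pose proof (pole_ge k). pose proof (wgt_pos k). pose proof (den_pos s k Hs).
    apply Rlt_le, Rdiv_lt_0_compat; [nra|assumption].
Qed.

Lemma P_pos (s : C) : 0 <= Re s -> Rabs (Im s) <= 2 -> 0 < Re (pfun r s).
Proof.
  intros Hs Ht. eapply Rlt_le_trans; [|apply (P_ge_term s 0 Hs Ht)].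
  pose proof (pole_ge 0). pose proof (wgt_pos 0). apply Rdiv_lt_0_compat; lra.
Qed.

Lemma P_term_le (s : C) n : 0 <= Re s ->
  wgt r n * (Re s + pole r n) / ((Re s + pole r n) ^ 2 + Im s ^ 2) <= (1 / 2) ^ n * (r n / (Re s + pole r n)).
Proof.
  intros Hs. pose proof (pole_ge n). pose proof (wgt_pos n). pose proof (den_pos s n Hs).
  assert (HD : (Re s + pole r n) ^ 2 <= (Re s + pole r n) ^ 2 + Im s ^ 2).
  { pose proof (pow2_ge_0 (Im s)). lra. }
  assert (HX : 0 < Re s + pole r n) by lra. unfold wgt in *.
  set (D := (Re s + pole r n) ^ 2 + Im s ^ 2) in *. set (X := Re s + pole r n) in *.
  apply Rmult_le_reg_r with (D * X); [apply Rmult_lt_0_compat; assumption|].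
  replace ((1 / 2) ^ n * r n * X / D * (D * X)) with ((1 / 2) ^ n * r n * X ^ 2) by (field; lra).
  replace ((1 / 2) ^ n * (r n / X) * (D * X)) with ((1 / 2) ^ n * r n * D) by (field; lra).
  apply Rmult_le_compat_l; lra.
Qed.

(** Each term is at most [(1 / 2) ^ n / r n]. Smallness of [P] makes [p ^ 2 / 3] negligible beside
    [Ci * p] in the imaginary part of the field, and later [u] negligible beside [v ^ 2 / u]. *)
Lemma P_le_const (s : C) : 0 <= Re s -> Re (pfun r s) <= 1 / 5000.
Proof.
  intros Hs. replace (1 / 5000) with (2 * (1 / 10000)) by field.
  apply (is_series_le _ _ _ _) with (2 := P_series s Hs) (3 := is_series_half (1 / 10000)).
  intros n. eapply Rle_trans; [apply P_term_le, Hs|].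
  rewrite (Rmult_comm (1 / 10000)). apply Rmult_le_compat_l; [left; apply pow_half_pos|].
  pose proof (pole_ge n). specialize (rge n).
  apply Rmult_le_reg_r with (Re s + pole r n); [lra|]. unfold Rdiv at 1.
  rewrite Rmult_assoc, Rinv_l by lra. unfold pole in *. nra.
Qed.

(* AM-GM: [r / (x + r^2) <= 1 / (2 sqrt x)]. *)
Lemma P_le_sqrt (s : C) : 0 < Re s -> Re (pfun r s) <= / sqrt (Re s).
Proof.
  intros Hs. pose proof (sqrt_lt_R0 _ Hs) as Hq. pose proof (sqrt_sqrt (Re s) (Rlt_le _ _ Hs)) as Hqq.
  replace (/ sqrt (Re s)) with (2 * (/ 2 * / sqrt (Re s))) by (field; lra).
  assert (Hs' : 0 <= Re s) by lra.
  apply (is_series_le _ _ _ _) with (2 := P_series s Hs') (3 := is_series_half (/ 2 * / sqrt (Re s))).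
  intros n. eapply Rle_trans; [apply P_term_le, Hs'|].
  rewrite (Rmult_comm (/ 2 * / sqrt (Re s))). apply Rmult_le_compat_l; [left; apply pow_half_pos|].
  pose proof (pole_ge n). specialize (rge n).
  apply Rmult_le_reg_r with (Re s + pole r n); [lra|]. unfold Rdiv at 1.
  rewrite Rmult_assoc, Rinv_l by lra.
  apply Rmult_le_reg_r with (sqrt (Re s)); [lra|].
  replace (/ 2 * / sqrt (Re s) * (Re s + pole r n) * sqrt (Re s)) with (/ 2 * (Re s + pole r n)) by (field; lra).
  unfold pole in *. set (q := sqrt (Re s)) in *. pose proof (pow2_ge_0 (r n - q)). nra.
Qed.

(** With [X = Re s + 10^8], all poles being at least [10^8], a termwise comparison gives
    [X * Q <= P]; the term of index 0, of residue [10^4], gives [X * P >= 9900]. Hence [Q] is at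
    most [P ^ 2 / 9900]. The term of index 0 therefore keeps [p] slowly varying wherever the
    remaining poles are put. *)
Lemma p_strip (s : C) : 0 <= Re s -> Rabs (Im s) <= 2 ->
  Cmod (pfun1 r s) <= 0.0003 * Re (pfun r s) ^ 2 /\ Rabs (Im (pfun r s)) <= 0.0003 * Re (pfun r s) ^ 2.
Proof.
  intros Hs Ht. destruct (Q_series s Hs) as (Q & HQ & EI & B).
  pose proof (P_pos s Hs Ht) as HP.
  pose proof (P_ge_term s 0 Hs Ht) as H0. set (P := Re (pfun r s)) in *.
  assert (Q0 : 0 <= Q). { eapply Rle_trans; [apply Cmod_ge_0|exact B]. }
  assert (E0 : wgt r 0 = 10000) by (unfold wgt; rewrite r0; simpl; ring).
  assert (E1 : pole r 0 = 100000000) by (unfold pole; rewrite r0; simpl; ring).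
  rewrite E0, E1 in H0. set (X := Re s + 100000000) in *. assert (HX : 0 < X) by (unfold X; lra).
  assert (H1 : X * Q <= P).
  { apply (is_series_le _ _ _ _) with (2 := is_series_Rmult X _ _ HQ) (3 := P_series s Hs).
    intros n. pose proof (pole_ge n). pose proof (den_pos s n Hs). pose proof (wgt_pos n).
    unfold Rdiv. rewrite <- Rmult_assoc. apply Rmult_le_compat_r; [left; apply Rinv_0_lt_compat; assumption|].
    rewrite Rmult_comm. apply Rmult_le_compat_l; [lra|]. unfold X. lra. }
  assert (H2 : 9900 <= X * P).
  { apply Rmult_le_reg_r with (/ X); [apply Rinv_0_lt_compat; lra|].
    replace (X * P * / X) with P by (field; lra). unfold Rdiv in H0. lra. }
  assert (H3 : Q <= 0.00015 * P ^ 2).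
  { apply Rmult_le_reg_l with X; [lra|]. nra. }
  split; [|rewrite EI, Rabs_mult, Rabs_Ropp, (Rabs_pos_eq Q) by lra; nra]. nra.
Qed.

(** Writing [p = P + i T], the two errors are [T - T ^ 2 / 3] and [- 2 P T / 3]. The first is
    measured against [P ^ 2], which is why [p_strip] bounds [T] by a multiple of [P ^ 2] and not of
    [P]. *)
Lemma fld_strip (s : C) : 0 <= Re s -> Rabs (Im s) <= 2 ->
  Rabs (- Re (field_F r s) - Re (pfun r s) ^ 2 / 3) <= 0.001 * Re (pfun r s) ^ 2 /\
  Rabs (Im (field_F r s) - Re (pfun r s)) <= 0.001 * Re (pfun r s).
Proof.
  intros Hs Ht. pose proof (P_pos s Hs Ht) as HP. pose proof (P_le_const s Hs) as HP'.
  destruct (p_strip s Hs Ht) as (_ & HT). unfold field_F. destruct (pfun r s) as [P T].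
  unfold Re, Im in *. simpl in *. rewrite Rmult_1_r in *.
  apply Rabs_le_between in HT.
  assert (HT2 : T * T <= 0.0003 * 0.0003 * (P * P)).
  { assert (P * P <= P) by nra. assert (T * T <= (0.0003 * (P * P)) * (0.0003 * (P * P))) by nra. nra. }
  assert (P * P <= P / 5000) by nra.
  assert (0 <= P * P) by nra. pose proof (Rle_0_sqr T) as HT3. unfold Rsqr in HT3.
  split; apply Rabs_le_between.
  - lra.
  - assert (Rabs (P * T) <= 0.0003 * P).
    { rewrite Rabs_mult, (Rabs_pos_eq P) by lra.
      assert (Rabs T <= 0.0003) by (apply Rabs_le_between; lra). nra. }
    apply Rabs_le_between in H1. lra.
Qed.

Lemma fld_primitive : exists F : C -> C, forall s, -1 < Re s -> cderiv F s (field_F r s).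
Proof.
  (* The constant is the largest of the three required: the derivative of the field has Lipschitz
     constant [8 + 2/3 (4 * 4 + 4 * 8) = 40]. *)
  apply (exists_primitive (field_F r) (fun s => - RtoC (2 / 3) * (pfun r s * pfun1 r s) + Ci * pfun1 r s)%C 40).
  - lra.
  - intros s v Hs Hv. unfold field_F, pfun, pfun1.
    pose proof (stj_quad _ _ pole_ge2 wgt_bound s v Hs Hv) as H1.
    pose proof (stj_lip _ _ pole_ge2 wgt_bound s v Hs Hv) as H2.
    pose proof (stj_bound _ _ pole_ge2 wgt_bound s Hs) as H3.
    set (a := stieltjes (wgt r) (pole r) v) in *. set (b := stieltjes (wgt r) (pole r) s) in *.
    set (c := stieltjes1 (wgt r) (pole r) s) in *. set (w := (v - s)%C) in *.
    set (e := (a - b - c * w)%C) in *.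
    replace (- RtoC (1 / 3) * (a * a) + Ci * a - (- RtoC (1 / 3) * (b * b) + Ci * b) -
      (- RtoC (2 / 3) * (b * c) + Ci * c) * w)%C
      with (- RtoC (1 / 3) * ((a - b) * (a - b)) + (Ci * e - RtoC (2 / 3) * (b * e)))%C.
    2:{ unfold e. replace (RtoC (2 / 3)) with (RtoC (1 / 3) + RtoC (1 / 3))%C
          by (rewrite <- RtoC_plus; f_equal; field). ring. }
    eapply Rle_trans; [apply Cmod_triangle|].
    pose proof (Cmod_minus_triangle (Ci * e)%C (RtoC (2 / 3) * (b * e))%C) as H4.
    rewrite !Cmod_mult, ?Cmod_opp, ?Cmod_R, ?Cmod_Ci in *.
    rewrite (Rabs_pos_eq (1 / 3)) in * by lra. rewrite (Rabs_pos_eq (2 / 3)) in * by lra.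
    pose proof (Cmod_ge_0 b). pose proof (Cmod_ge_0 e). pose proof (Cmod_ge_0 (a - b)%C).
    pose proof (Cmod_ge_0 w).
    assert (Cmod (a - b)%C * Cmod (a - b)%C <= 16 * Cmod w ^ 2) by nra.
    assert (Cmod b * Cmod e <= 4 * (4 * Cmod w ^ 2)) by (apply Rmult_le_compat; assumption).
    nra.
  - intros s v Hs Hv. unfold pfun, pfun1.
    pose proof (stj1_lip _ _ pole_ge2 wgt_bound s v Hs Hv) as H1.
    pose proof (stj_lip _ _ pole_ge2 wgt_bound s v Hs Hv) as H2.
    pose proof (stj_bound _ _ pole_ge2 wgt_bound s Hs) as H3.
    pose proof (stj1_bound _ _ pole_ge2 wgt_bound v Hv) as H3'.
    set (a := stieltjes (wgt r) (pole r) v) in *. set (b := stieltjes (wgt r) (pole r) s) in *.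
    set (c := stieltjes1 (wgt r) (pole r) s) in *. set (d := stieltjes1 (wgt r) (pole r) v) in *.
    set (w := (v - s)%C) in *.
    replace (- RtoC (2 / 3) * (a * d) + Ci * d - (- RtoC (2 / 3) * (b * c) + Ci * c))%C
      with (Ci * (d - c) - RtoC (2 / 3) * ((a - b) * d + b * (d - c)))%C by ring.
    eapply Rle_trans; [apply Cmod_minus_triangle|].
    rewrite (Cmod_mult (RtoC (2 / 3))).
    pose proof (Cmod_triangle ((a - b) * d)%C (b * (d - c))%C) as H4.
    rewrite !Cmod_mult, ?Cmod_opp, ?Cmod_R, ?Cmod_Ci in *.
    rewrite (Rabs_pos_eq (2 / 3)) in * by lra.
    assert (Cmod (a - b)%C * Cmod d <= 4 * Cmod w * 4) by (apply Rmult_le_compat; try assumption; apply Cmod_ge_0).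
    assert (Cmod b * Cmod (d - c)%C <= 4 * (8 * Cmod w)) by (apply Rmult_le_compat; try assumption; apply Cmod_ge_0).
    pose proof (Cmod_ge_0 w). lra.
  - intros s Hs. unfold pfun, pfun1.
    pose proof (stj_bound _ _ pole_ge2 wgt_bound s Hs) as H3.
    pose proof (stj1_bound _ _ pole_ge2 wgt_bound s Hs) as H3'.
    eapply Rle_trans; [apply Cmod_triangle|].
    rewrite !Cmod_mult, ?Cmod_opp, ?Cmod_R, ?Cmod_Ci in *.
    rewrite (Rabs_pos_eq (2 / 3)) in * by lra.
    match goal with |- 2 / 3 * (?x * ?y) + _ <= _ =>
      assert (x * y <= 4 * 4) by (apply Rmult_le_compat; try assumption; apply Cmod_ge_0) end.
    lra.
Qed.

(* On the real axis [- 2 env'] dominates [p^2], which makes the integral of [p^2] converge. *)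
Definition env (s : C) : C := stieltjes (fun n => (1 / 2) ^ n * pole r n) (pole r) s.
Definition env1 (s : C) : C := stieltjes1 (fun n => (1 / 2) ^ n * pole r n) (pole r) s.

Lemma env_weight n : 0 <= (1 / 2) ^ n * pole r n <= (1 / 2) ^ n * pole r n.
Proof.
  split; [|lra]. apply Rmult_le_pos; [left; apply pow_half_pos|]. pose proof (pole_ge n). lra.
Qed.

Lemma env_cderiv (s : C) : -1 < Re s -> cderiv env s (env1 s).
Proof. apply stj_cderiv; [apply pole_ge2|apply env_weight]. Qed.

Lemma env_bound (s : C) : -1 < Re s -> Cmod (env s) <= 4.
Proof. apply stj_bound; [apply pole_ge2|apply env_weight]. Qed.

(* Cauchy-Schwarz for the weights 2^-n, whose sum is 2. *)
Lemma P_sq_le_env1 (x : R) : 0 <= x -> Re (pfun r (RtoC x)) ^ 2 <= - 2 * Re (env1 (RtoC x)).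
Proof.
  intros Hx. set (s := RtoC x). assert (Es : Re s = x) by reflexivity. assert (Et : Im s = 0) by reflexivity.
  assert (Hs : 0 <= Re s) by lra.
  pose proof (P_series s Hs) as H1.
  destruct (stj1_summable _ _ pole_ge2 env_weight s) as (H2 & _); [lra|].
  fold (env1 s) in H2. set (P := Re (pfun r s)) in *.
  pose proof (is_series_half (P ^ 2 / 4)) as H3.
  pose proof (is_series_plus _ _ _ _ (is_series_Rmult (-1) _ _ H2)
    (is_series_plus _ _ _ _ (is_series_Rmult (- P) _ _ H1) H3)) as H4.
  (* Cauchy-Schwarz in the form [sum 2^-n (g_n - P / 2) ^ 2 >= 0] with [g_n = r n / (x + pole r n)]:
     the weights have total mass 2, so [P / 2] is the mean of the [g_n]. *)
  assert (H5 : 0 * (2 * 0) <= -1 * Re (env1 s) + (- P * P + 2 * (P ^ 2 / 4))).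
  { apply (is_series_le _ _ _ _) with (2 := is_series_Rmult 0 _ _ (is_series_half 0)) (3 := H4).
    intros n. rewrite Rmult_0_l.
    change (0 <= -1 * Re (- (1) * (RtoC ((1 / 2) ^ n * pole r n) / ((s + RtoC (pole r n)) * (s + RtoC (pole r n)))))%C
      + (- P * (wgt r n * (Re s + pole r n) / ((Re s + pole r n) ^ 2 + Im s ^ 2)) + P ^ 2 / 4 * (1 / 2) ^ n)).
    pose proof (pole_ge n). pose proof (pow_half_pos n).
    rewrite Es, Et.
    assert (E : -1 * Re (- (1) * (RtoC ((1 / 2) ^ n * pole r n) / ((s + RtoC (pole r n)) * (s + RtoC (pole r n)))))%C
      = (1 / 2) ^ n * (r n / (x + pole r n)) ^ 2).
    { unfold s. rewrite <- RtoC_plus, <- RtoC_mult, <- RtoC_div by (apply Rgt_not_eq; nra).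
      rewrite <- RtoC_opp, <- RtoC_mult.
      unfold Re; simpl fst. unfold pole in *. field. lra. }
    rewrite E. unfold wgt.
    replace ((1 / 2) ^ n * r n * (x + pole r n) / ((x + pole r n) ^ 2 + 0 ^ 2))
      with ((1 / 2) ^ n * (r n / (x + pole r n))) by (field; lra).
    set (g := r n / (x + pole r n)).
    replace ((1 / 2) ^ n * g ^ 2 + (- P * ((1 / 2) ^ n * g) + P ^ 2 / 4 * (1 / 2) ^ n))
      with ((1 / 2) ^ n * (g - P / 2) ^ 2) by field.
    apply Rmult_le_pos; [lra|apply pow2_ge_0]. }
  nra.
Qed.

Lemma fld_real (x : R) : 0 <= x -> Re (field_F r (RtoC x)) = - (Re (pfun r (RtoC x)) ^ 2) / 3.
Proof.
  intros Hx. destruct (Q_series (RtoC x)) as (Q & _ & E & _); [exact Hx|].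
  unfold field_F. destruct (pfun r (RtoC x)) as [P T]. unfold Re, Im in *. simpl in *.
  rewrite E. field.
Qed.

End Field.

(** * The primitive F *)

(** The height 2 exceeds [PI / 2], so this set contains the image of the closed disc without the
    point 1 under the logarithmic chart. Being convex, it also contains all mean value points. *)
Definition strip (s : C) : Prop := 0 <= Re s /\ Rabs (Im s) <= 2.

Lemma strip_segment (s1 s2 : C) (t : R) : strip s1 -> strip s2 -> 0 <= t <= 1 ->
  strip (s1 + RtoC t * (s2 - s1))%C.
Proof.
  destruct s1 as [x1 y1], s2 as [x2 y2]. unfold strip, Re, Im. simpl.
  rewrite !Rabs_le_between. intros H1 H2 Ht.
  repeat split; nra.
Qed.

Lemma strip_gt s : strip s -> -1 < Re s.
Proof. intros (H & _). lra. Qed.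

Lemma strip_pair x y : 0 <= x -> Rabs y <= 2 -> strip (x, y).
Proof. intros; split; assumption. Qed.

Section Map.
Variable r : nat -> R.
Hypothesis r0 : r 0%nat = 10000.
Hypothesis rge : forall n, 10000 <= r n.

Section Normalise.
Variable F : C -> C.
Hypothesis HF : forall s, -1 < Re s -> cderiv F s (field_F r s).

Lemma strip_mvt (s1 s2 c : C) : strip s1 -> strip s2 ->
  exists t, 0 <= t <= 1 /\
    Re (c * (F s2 - F s1))%C = Re (c * (s2 - s1) * field_F r (s1 + RtoC t * (s2 - s1)))%C.
Proof.
  intros H1 H2. apply complex_mvt. intros t Ht. apply HF, strip_gt, strip_segment; assumption.
Qed.

Lemma fld_re_neg s : strip s -> Re (field_F r s) <= - 0.332 * Re (pfun r s) ^ 2.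
Proof.
  intros (H1 & H2). destruct (fld_strip r r0 rge s H1 H2) as (A & _).
  apply Rabs_le_between in A. pose proof (pow2_ge_0 (Re (pfun r s))). lra.
Qed.

Lemma fld_im_pos s : strip s -> 0 < Im (field_F r s) <= 1.001 * Re (pfun r s).
Proof.
  intros (H1 & H2). destruct (fld_strip r r0 rge s H1 H2) as (_ & A).
  pose proof (P_pos r rge s H1 H2). apply Rabs_le_between in A. lra.
Qed.

Lemma Re_horizontal (x1 x2 y : R) : 0 <= x1 < x2 -> Rabs y <= 2 -> Re (F (x2, y)) < Re (F (x1, y)).
Proof.
  intros Hx Hy.
  destruct (strip_mvt (x1, y) (x2, y) 1) as (t & Ht & E); try (apply strip_pair; lra).
  set (z := ((x1, y) + RtoC t * ((x2, y) - (x1, y)))%C) in *.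
  assert (Hz : strip z) by (apply strip_segment; try (apply strip_pair); lra).
  pose proof (fld_re_neg z Hz) as H. destruct Hz as (Hz1 & Hz2).
  pose proof (P_pos r rge z Hz1 Hz2).
  assert (E2 : Re (F (x2, y)) - Re (F (x1, y)) = (x2 - x1) * Re (field_F r z)).
  { revert E. destruct (F (x2, y)), (F (x1, y)), (field_F r z). unfold Re. simpl. lra. }
  assert (Re (field_F r z) < 0) by nra. nra.
Qed.

Lemma Re_vertical (x y1 y2 : R) : 0 <= x -> Rabs y1 <= 2 -> Rabs y2 <= 2 ->
  exists z, Re z = x /\ strip z /\ Re (F (x, y2)) - Re (F (x, y1)) = - (y2 - y1) * Im (field_F r z).
Proof.
  intros Hx H1 H2.
  destruct (strip_mvt (x, y1) (x, y2) 1) as (t & Ht & E); try (apply strip_pair; lra).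
  set (z := ((x, y1) + RtoC t * ((x, y2) - (x, y1)))%C) in *.
  exists z. split; [unfold z, Re; simpl; ring|].
  split; [apply strip_segment; try (apply strip_pair); lra|].
  revert E. destruct (F (x, y2)), (F (x, y1)), (field_F r z). unfold Re, Im. simpl. lra.
Qed.

(** On the real axis [Re F - (2 / 3) Re env] is nondecreasing, since [P ^ 2 <= - 2 Re env1]. As
    [env] is bounded by 4, [Re F] loses at most [16 / 3]. *)
Lemma Re_real_axis_bounded (x : R) : 0 <= x -> Re (F (RtoC 0)) - 6 <= Re (F (RtoC x)).
Proof.
  intros Hx.
  destruct (complex_mvt (fun s => F s + RtoC (- (2 / 3)) * env r s)%C
    (fun s => field_F r s + RtoC (- (2 / 3)) * env1 r s)%C (RtoC 0) (RtoC x) 1%C) as (t & Ht & E).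
  - intros t Ht. set (z := (RtoC 0 + RtoC t * (RtoC x - RtoC 0))%C).
    assert (Hz : -1 < Re z) by (unfold z, Re; simpl; nra).
    apply cderiv_plus; [apply HF; exact Hz|]. apply cderiv_scal. apply env_cderiv; assumption.
  - replace (RtoC 0 + RtoC t * (RtoC x - RtoC 0))%C with (RtoC (t * x)) in E
      by (rewrite RtoC_mult; ring).
    assert (Htx : 0 <= t * x) by nra.
    pose proof (fld_real r rge (t * x) Htx) as E1.
    pose proof (P_sq_le_env1 r rge (t * x) Htx) as E2.
    assert (B1 : Cmod (env r (RtoC 0)) <= 4) by (apply env_bound; [assumption|unfold Re; simpl; lra]).
    assert (B2 : Cmod (env r (RtoC x)) <= 4) by (apply env_bound; [assumption|unfold Re; simpl; lra]).
    pose proof (re_le_Cmod (env r (RtoC 0))) as B3. pose proof (re_le_Cmod (env r (RtoC x))) as B4.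
    assert (B5 : Rabs (Re (env r (RtoC 0))) <= 4) by lra.
    assert (B6 : Rabs (Re (env r (RtoC x))) <= 4) by lra.
    apply Rabs_le_between in B5. apply Rabs_le_between in B6. clear B1 B2 B3 B4.
    set (P := Re (pfun r (RtoC (t * x)))) in *. clearbody P.
    revert E E1 E2 B5 B6. generalize (F (RtoC x)) (F (RtoC 0)) (field_F r (RtoC (t * x)))
      (env1 r (RtoC (t * x))) (env r (RtoC 0)) (env r (RtoC x)).
    intros a b f e1 e0 ex. destruct a, b, f, e1, e0, ex. unfold Re. simpl. nra.
Qed.

(** On the real axis [Re F] decreases and is bounded below. On the vertical segment at abscissa [x]
    it oscillates by at most about [2 P], and [P <= / sqrt x]; hence every horizontal line has the
    same limit. *)
Lemma Re_limit : exists l : R, forall y eps, Rabs y <= 2 -> 0 < eps ->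
  exists S, 0 <= S /\ forall x, S <= x -> Rabs (Re (F (x, y)) - l) < eps.
Proof.
  destruct (completeness (fun z => exists x, 0 <= x /\ z = - Re (F (RtoC x)))) as (m & Hub & Hlub).
  { exists (6 - Re (F (RtoC 0))). intros z (x & Hx & ->). pose proof (Re_real_axis_bounded x Hx). lra. }
  { exists (- Re (F (RtoC 0))). exists 0. split; [lra|reflexivity]. }
  exists (- m). intros y eps Hy Heps.
  assert (Hex : exists x0, 0 <= x0 /\ Re (F (RtoC x0)) < - m + eps / 2).
  { destruct (classic (exists x0, 0 <= x0 /\ Re (F (RtoC x0)) < - m + eps / 2)) as [H|H]; [exact H|].
    exfalso. assert (m <= m - eps / 2); [|lra]. apply Hlub. intros z (x & Hx & ->).
    destruct (Rlt_le_dec (Re (F (RtoC x))) (- m + eps / 2)) as [H1|H1]; [|lra].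
    exfalso. apply H. exists x. split; assumption. }
  destruct Hex as (x0 & Hx0 & H0).
  (* Beyond [q ^ 2] one has [P <= / q = eps / 8], so the vertical oscillation stays below the
     remaining [eps / 2]. *)
  set (q := 8 / eps). assert (Hq : 0 < q) by (apply Rdiv_lt_0_compat; lra).
  exists (x0 + q ^ 2). split; [nra|]. intros x Hx.
  assert (Hxq : q ^ 2 <= x) by lra. assert (Hq2 : 0 < q ^ 2) by nra.
  assert (A1 : - m <= Re (F (RtoC x))).
  { assert (- Re (F (RtoC x)) <= m); [|lra]. apply Hub. exists x. split; [lra|reflexivity]. }
  assert (A2 : Re (F (RtoC x)) < - m + eps / 2).
  { eapply Rlt_trans; [|exact H0]. apply (Re_horizontal x0 x 0); [lra|]. rewrite Rabs_R0. lra. }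
  destruct (Re_vertical x 0 y) as (z & Ez & Hz & E); try lra; [rewrite Rabs_R0; lra|].
  pose proof (fld_im_pos z Hz) as Hi.
  assert (HP : Re (pfun r z) <= eps / 8).
  { eapply Rle_trans; [apply P_le_sqrt; [assumption|lra]|].
    rewrite Ez. replace (eps / 8) with (/ q) by (unfold q; field; lra).
    apply Rinv_le_contravar; [assumption|]. rewrite <- (sqrt_pow2 q) by lra. apply sqrt_le_1; lra. }
  change (RtoC x) with ((x, 0) : C) in *.
  apply Rabs_le_between in Hy. apply Rabs_lt_between. rewrite Rminus_0_r in E.
  assert (Rabs (y * Im (field_F r z)) <= 2 * (1.001 * (eps / 8))).
  { rewrite Rabs_mult. apply Rmult_le_compat; try apply Rabs_pos.
    - apply Rabs_le_between. lra.
    - rewrite Rabs_pos_eq by lra. lra. }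
  apply Rabs_le_between in H. lra.
Qed.

End Normalise.

(** Subtracting the common limit makes [Re F] tend to 0, so that [exp (- F)] approaches modulus 1
    exactly, towards the end of the strip. *)
Lemma exists_map : exists F : C -> C, (forall s, -1 < Re s -> cderiv F s (field_F r s)) /\
  forall y eps, Rabs y <= 2 -> 0 < eps ->
    exists S, 0 <= S /\ forall x, S <= x -> Rabs (Re (F (x, y))) < eps.
Proof.
  destruct (fld_primitive r rge) as (F & HF).
  destruct (Re_limit F HF) as (l & Hl).
  exists (fun s => F s + RtoC (- l))%C. split.
  - intros s Hs. replace (field_F r s) with (field_F r s + 0)%C by ring.
    apply cderiv_plus; [apply HF, Hs|apply cderiv_const].
  - intros y eps Hy He. destruct (Hl y eps Hy He) as (S & HS & H). exists S. split; [exact HS|].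
    intros x Hx. exact (H x Hx).
Qed.

Section Geometry.
Variable F : C -> C.
Hypothesis HF : forall s, -1 < Re s -> cderiv F s (field_F r s).
Hypothesis Hlim : forall y eps, Rabs y <= 2 -> 0 < eps ->
    exists S, 0 <= S /\ forall x, S <= x -> Rabs (Re (F (x, y))) < eps.

(** Along each horizontal line [Re F] decreases strictly to its limit 0. *)
Lemma Re_map_pos s : strip s -> 0 < Re (F s).
Proof.
  destruct s as [x y]. intros (Hx & Hy). unfold Re, Im in Hx, Hy. simpl in Hx, Hy.
  destruct (Rlt_le_dec 0 (Re (F (x, y)))) as [H|H]; [exact H|exfalso].
  pose proof (Re_horizontal F HF x (x + 1) y ltac:(lra) Hy) as H1.
  destruct (Hlim y (- Re (F (x + 1, y))) Hy) as (S & HS & HL); [lra|].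
  pose proof (Rmax_l S (x + 2)) as M1. pose proof (Rmax_r S (x + 2)) as M2.
  specialize (HL (Rmax S (x + 2)) ltac:(lra)).
  pose proof (Re_horizontal F HF (x + 1) (Rmax S (x + 2)) y ltac:(lra) Hy) as H3.
  apply Rabs_lt_between in HL. lra.
Qed.

(** The nth term alone forces [Re F] to decrease at least as fast as the real part of
    [c / (s + pole r n)]. Both tend to 0 along a horizontal line, so [Re F] is at least that real
    part, which at abscissas up to the pole distance is still of order
    [wgt r n ^ 2 / pole r n = (1 / 4) ^ n]. *)
Lemma Re_map_lower s n : strip s -> Re s <= pole r n -> 0.1 * (1 / 4) ^ n <= Re (F s).
Proof.
  destruct s as [x y]. intros (Hx & Hy) Hn. unfold Re, Im in Hx, Hy, Hn. simpl in Hx, Hy, Hn.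
  (* The value 0.3 stays below [0.332 * (99 / 100) ^ 2], the rate guaranteed by the nth term, and
     leaves about [0.15 * (1 / 4) ^ n] at [Re s = pole r n]. *)
  set (c := 0.3 * wgt r n ^ 2). set (R0 := pole r n) in *.
  pose proof (wgt_pos r rge n) as Hw. pose proof (pole_ge r rge n) as HR. fold R0 in HR.
  assert (Hc : 0 < c) by (unfold c; nra).
  set (H := fun s : C => (F s + RtoC (- c) * / (s + RtoC R0))%C).
  assert (Hmono : forall x2, x < x2 -> Re (H (x2, y)) <= Re (H (x, y))).
  { intros x2 Hx2.
    destruct (complex_mvt H (fun s => field_F r s + RtoC (- c) * (- / ((s + RtoC R0) * (s + RtoC R0)) * (1 + 0)))%C
      (x, y) (x2, y) 1%C) as (t & Ht & E).
    - intros t Ht. set (z := ((x, y) + RtoC t * ((x2, y) - (x, y)))%C).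
      assert (Hz : strip z) by (apply strip_segment; try (apply strip_pair); lra).
      unfold H. apply cderiv_plus; [apply HF, strip_gt, Hz|].
      apply cderiv_scal. apply (cderiv_inv (fun s => s + RtoC R0)%C).
      + destruct Hz as (Hz & _). apply Cmod_gt_0. pose proof (Cmod_plus_R_ge z R0). lra.
      + apply cderiv_plus; [apply cderiv_id|apply cderiv_const].
    - set (z := ((x, y) + RtoC t * ((x2, y) - (x, y)))%C) in *.
      assert (Hz : strip z) by (apply strip_segment; try (apply strip_pair); lra).
      pose proof (fld_re_neg z Hz) as Hf. destruct Hz as (Hz1 & Hz2).
      pose proof (P_ge_term r rge z n Hz1 Hz2) as HP. fold R0 in HP.
      set (X := Re z + R0) in *. assert (HX : 0 < X) by (unfold X; lra).
      assert (HX2 : X <= Cmod (z + RtoC R0)%C) by apply Cmod_plus_R_ge.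
      assert (Hinv : Re (/ ((z + RtoC R0) * (z + RtoC R0)))%C <= / X ^ 2).
      { eapply Rle_trans; [apply Re_le|].
        assert (N : (z + RtoC R0)%C <> 0%C) by (apply Cmod_gt_0; lra).
        rewrite Cmod_inv by (apply Cmult_neq_0; assumption). rewrite Cmod_mult.
        apply Rinv_le_contravar; nra. }
      assert (HPP : ((99 / 100) * wgt r n / X) ^ 2 <= Re (pfun r z) ^ 2).
      { apply pow_incr. split; [|exact HP]. apply Rlt_le, Rdiv_lt_0_compat; lra. }
      replace (((99 / 100) * wgt r n / X) ^ 2) with ((9801 / 10000) * wgt r n ^ 2 * / X ^ 2) in HPP by (field; lra).
      assert (0 < / X ^ 2) by (apply Rinv_0_lt_compat; nra).
      assert (Hd : Re (field_F r z) + c * Re (/ ((z + RtoC R0) * (z + RtoC R0)))%C <= 0).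
      { assert (c * Re (/ ((z + RtoC R0) * (z + RtoC R0)))%C <= c * / X ^ 2)
          by (apply Rmult_le_compat_l; lra).
        assert (0 < wgt r n ^ 2) by nra.
        assert (0 < wgt r n ^ 2 * / X ^ 2) by (apply Rmult_lt_0_compat; assumption).
        unfold c in *. nra. }
      revert E Hd. generalize (/ ((z + RtoC R0) * (z + RtoC R0)))%C (H (x2, y)) (H (x, y)) (field_F r z).
      intros i a b f. destruct i, a, b, f. unfold Re. simpl. nra. }
  assert (HH : forall x', 0 <= x' -> Re (H (x', y)) = Re (F (x', y)) - c * (x' + R0) / ((x' + R0) ^ 2 + y ^ 2)).
  { intros x' Hx'. unfold H. generalize (F (x', y)). intros [a b]. unfold Re. simpl. field. nra. }
  assert (Hy2 : y ^ 2 <= 4). { rewrite <- pow2_abs. pose proof (Rabs_pos y). nra. }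
  pose proof (pow2_ge_0 y) as Hy0.
  assert (Hpos : 0 <= Re (H (x, y))).
  { destruct (Rlt_le_dec (Re (H (x, y))) 0) as [N|N]; [exfalso|exact N].
    set (e := - Re (H (x, y))). assert (He : 0 < e) by (unfold e; lra).
    (* So far to the right that the correction [c / (s + R0)] has real part below [e], while [Re F]
       is still positive: this contradicts monotonicity of [Re H]. *)
    set (x' := x + 1 + c / e).
    assert (Hce : 0 < c / e) by (apply Rdiv_lt_0_compat; assumption).
    assert (Hx' : x < x') by (unfold x'; lra).
    specialize (Hmono x' Hx'). rewrite (HH x' ltac:(lra)) in Hmono.
    pose proof (Re_map_pos (x', y)) as HX. specialize (HX (strip_pair x' y ltac:(lra) Hy)).
    assert (c * (x' + R0) / ((x' + R0) ^ 2 + y ^ 2) < e); [|unfold e in *; lra].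
    assert (0 < (x' + R0) ^ 2 + y ^ 2) by nra.
    apply Rmult_lt_reg_r with ((x' + R0) ^ 2 + y ^ 2); [assumption|].
    unfold Rdiv. rewrite Rmult_assoc, Rinv_l, Rmult_1_r by lra.
    assert (c < e * (x' + R0)).
    { apply Rlt_le_trans with (e * (c / e + 1)); [|apply Rmult_le_compat_l; unfold x'; lra].
      replace (e * (c / e + 1)) with (c + e) by (field; lra). lra. }
    assert (0 < x' + R0) by lra. nra. }
  rewrite (HH x Hx) in Hpos.
  assert (Hfin : 0.1 * (1 / 4) ^ n <= c * (x + R0) / ((x + R0) ^ 2 + y ^ 2)); [|lra].
  assert (HD : 0 < (x + R0) ^ 2 + y ^ 2) by nra.
  apply Rmult_le_reg_r with ((x + R0) ^ 2 + y ^ 2); [assumption|].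
  replace (c * (x + R0) / ((x + R0) ^ 2 + y ^ 2) * ((x + R0) ^ 2 + y ^ 2)) with (c * (x + R0))
    by (field; lra).
  assert (Ec : c = 0.3 * ((1 / 4) ^ n * R0)).
  { unfold c, wgt, R0, pole. replace (1 / 4) with (1 / 2 * (1 / 2)) by field.
    rewrite (Rpow_mult_distr (1 / 2) (1 / 2) n). ring. }
  rewrite Ec. assert (Hq : 0 < (1 / 4) ^ n) by (apply pow_lt; lra).
  set (q := (1 / 4) ^ n) in *.
  replace (0.1 * q * ((x + R0) ^ 2 + y ^ 2)) with (q * (0.1 * ((x + R0) ^ 2 + y ^ 2))) by ring.
  replace (0.3 * (q * R0) * (x + R0)) with (q * (0.3 * R0 * (x + R0))) by ring.
  apply Rmult_le_compat_l; [lra|]. nra.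
Qed.

End Geometry.
End Map.

(** * Level sets of Re F *)

(** Accurate enough for the covering argument, where [2.9 * (5 / 2)] has to exceed [2 * PI]. *)
Lemma PI_lt : PI < 17 / 5.
Proof.
  assert (H : cos (17 / 10) < 0).
  { destruct (pre_cos_bound (17 / 10) 0) as (_ & H); [lra|lra|].
    eapply Rle_lt_trans; [exact H|]. unfold cos_approx, cos_term. simpl. lra. }
  destruct (Rlt_le_dec PI (17 / 5)) as [P|P]; [exact P|exfalso].
  assert (0 <= cos (17 / 10)); [|lra]. apply cos_ge_0; lra.
Qed.

Section Level.
Variable r : nat -> R.
Hypothesis r0 : r 0%nat = 10000.
Hypothesis rge : forall n, 10000 <= r n.
Variable F : C -> C.
Hypothesis HF : forall s, -1 < Re s -> cderiv F s (field_F r s).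

Lemma pfun_neq s : strip s -> pfun r s <> 0%C.
Proof.
  intros (H1 & H2) E. pose proof (P_pos r rge s H1 H2) as H. rewrite E in H.
  unfold Re in H. simpl in H. lra.
Qed.

(* [1/p] has derivative [-p'/p^2], of modulus at most 0.0003. *)
Lemma pfun_inv_lip (s1 s2 : C) : strip s1 -> strip s2 ->
  Cmod (/ pfun r s2 - / pfun r s1)%C <= 0.0003 * Cmod (s2 - s1)%C.
Proof.
  intros H1 H2.
  destruct (complex_mvt_ineq (fun s => / pfun r s)%C
    (fun s => - / (pfun r s * pfun r s) * pfun1 r s)%C s1 s2) as (t & Ht & E).
  - intros t Ht. pose proof (strip_segment s1 s2 t H1 H2 Ht) as Hz.
    apply cderiv_inv; [apply pfun_neq, Hz|].
    apply stj_cderiv; [apply pole_ge2, rge|apply wgt_bound, rge|apply strip_gt, Hz].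
  - eapply Rle_trans; [exact E|]. rewrite Rmult_comm.
    apply Rmult_le_compat_r; [apply Cmod_ge_0|].
    set (z := (s1 + RtoC t * (s2 - s1))%C) in *.
    assert (Hz : strip z) by (apply strip_segment; assumption).
    pose proof (pfun_neq z Hz) as N. destruct Hz as (Hz1 & Hz2).
    pose proof (P_pos r rge z Hz1 Hz2) as HP.
    destruct (p_strip r r0 rge z Hz1 Hz2) as (B & _).
    pose proof (Re_le (pfun r z)) as HR.
    rewrite Cmod_mult, Cmod_opp, Cmod_inv, Cmod_mult by (apply Cmult_neq_0; assumption).
    set (P := Re (pfun r z)) in *. set (m := Cmod (pfun r z)) in *.
    apply Rmult_le_reg_l with (m * m); [nra|].
    rewrite <- Rmult_assoc, Rinv_r, Rmult_1_l by nra. nra.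
Qed.

(* [v^2 <= 3.2 u] holds pointwise, and the set [v^2 <= 3.2 u] is convex: it is tested on the tangent
   line of the parabola at the slope [v] itself. *)
Lemma chord (s1 s2 : C) : strip s1 -> strip s2 -> s1 <> s2 ->
  exists u v : R, (F s2 - F s1)%C = ((s2 - s1) * (- u, v)%R)%C /\
    (exists z t, 0 <= t <= 1 /\ z = (s1 + RtoC t * (s2 - s1))%C /\ u = - Re (field_F r z)) /\
    (exists z t, 0 <= t <= 1 /\ z = (s1 + RtoC t * (s2 - s1))%C /\ v = Im (field_F r z)) /\
    v ^ 2 <= 3.2 * u.
Proof.
  intros H1 H2 N.
  assert (ND : (s2 - s1)%C <> 0%C).
  { intros E. apply N. replace s2 with (s2 - s1 + s1)%C by ring. rewrite E. ring. }
  set (W := ((F s2 - F s1) / (s2 - s1))%C).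
  assert (EW : (F s2 - F s1)%C = ((s2 - s1) * W)%C) by (unfold W; field; exact ND).
  assert (MV : forall c : C, exists t, 0 <= t <= 1 /\
    Re (c * W)%C = Re (c * field_F r (s1 + RtoC t * (s2 - s1)))%C).
  { intros c. destruct (strip_mvt r F HF s1 s2 (c / (s2 - s1))%C H1 H2) as (t & Ht & E).
    exists t. split; [exact Ht|].
    rewrite EW in E.
    replace (c / (s2 - s1) * ((s2 - s1) * W))%C with (c * W)%C in E by (field; exact ND).
    rewrite E. f_equal. field; exact ND. }
  exists (- Re W), (Im W). split.
  { rewrite EW, Ropp_involutive. reflexivity. }
  split; [|split].
  - destruct (MV 1%C) as (t & Ht & E). eexists; exists t. split; [exact Ht|]. split; [reflexivity|].
    rewrite !Cmult_1_l in E. rewrite E. reflexivity.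
  - destruct (MV (- Ci)%C) as (t & Ht & E). eexists; exists t. split; [exact Ht|]. split; [reflexivity|].
    revert E. generalize (field_F r (s1 + RtoC t * (s2 - s1))%C). intros f. destruct W, f.
    unfold Re, Im. simpl. lra.
  - destruct (MV ((- 3.2, 2 * Im W)%R)) as (t & Ht & E).
    set (z := (s1 + RtoC t * (s2 - s1))%C) in *.
    assert (Hz : strip z) by (apply strip_segment; assumption). destruct Hz as (Hz1 & Hz2).
    destruct (fld_strip r r0 rge z Hz1 Hz2) as (A & B).
    pose proof (P_pos r rge z Hz1 Hz2) as HP.
    apply Rabs_le_between in A. apply Rabs_le_between in B.
    set (P := Re (pfun r z)) in *.
    assert (K : Im (field_F r z) ^ 2 <= - 3.2 * Re (field_F r z)).
    { assert (Im (field_F r z) ^ 2 <= (1.001 * P) ^ 2) by (apply pow_incr; lra).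
      assert (0 < P ^ 2) by nra. nra. }
    revert E K. destruct W as [a b], (field_F r z) as [f g]. unfold Re, Im. simpl. intros E K.
    pose proof (Rle_0_sqr (b - g)) as S. unfold Rsqr in S. nra.
Qed.

(** Equality of the real parts reads [u dx = - v dy]; inserting [dx] into [v dx - u dy] gives
    [q = v ^ 2 / u + u]. The upper bound on [q] is the inequality [v ^ 2 <= 3.2 u] of [chord]. The
    lower bound compares [u], taken at [z], with [v], taken at [z'], and needs [P] at [z] to be at
    most about [P] at [z']. *)
Lemma level_set (s1 s2 : C) : strip s1 -> strip s2 -> Re (F s1) = Re (F s2) ->
  exists q, 2.9 <= q <= 3.3 /\ Im (F s2) - Im (F s1) = - q * (Im s2 - Im s1) /\
    (Im s1 = Im s2 -> s1 = s2).
Proof.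
  intros H1 H2 HE.
  destruct (excluded_middle_informative (s1 = s2)) as [N|N].
  (* For equal points any [q] in the range will do. *)
  { subst s2. exists 3. repeat split; try lra. }
  destruct (chord s1 s2 H1 H2 N) as (u & v & E & (z & t & Ht & Ez & Eu) & (z' & t' & Ht' & Ez' & Ev) & J).
  assert (Hz : strip z) by (rewrite Ez; apply strip_segment; assumption).
  assert (Hz' : strip z') by (rewrite Ez'; apply strip_segment; assumption).
  assert (E1 : - u * (Re s2 - Re s1) = v * (Im s2 - Im s1)).
  { revert E HE. destruct (F s2), (F s1), s2, s1. unfold Re, Im. simpl.
    intros E. injection E. intros. lra. }
  assert (E2 : Im (F s2) - Im (F s1) = v * (Re s2 - Re s1) - u * (Im s2 - Im s1)).
  { revert E. clear. destruct (F s2), (F s1), s2, s1. unfold Re, Im. simpl.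
    intros E. injection E. intros. lra. }
  clear E HE.
  pose proof (pfun_inv_lip z' z Hz' Hz) as L.
  pose proof (pfun_neq z Hz) as N1. pose proof (pfun_neq z' Hz') as N2.
  assert (HD : Cmod (z - z')%C <= Rabs (Re s2 - Re s1) + Rabs (Im s2 - Im s1)).
  { replace (z - z')%C with (RtoC (t - t') * (s2 - s1))%C
      by (rewrite Ez, Ez', RtoC_minus; ring).
    rewrite Cmod_mult, Cmod_R.
    assert (Rabs (t - t') <= 1) by (apply Rabs_le_between; lra).
    pose proof (Rabs_pos (t - t')). pose proof (Cmod_ge_0 (s2 - s1)%C).
    pose proof (Cmod_le_sum (s2 - s1)%C) as S.
    replace (Re (s2 - s1)%C) with (Re s2 - Re s1) in S by (destruct s1, s2; reflexivity).
    replace (Im (s2 - s1)%C) with (Im s2 - Im s1) in S by (destruct s1, s2; reflexivity).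
    nra. }
  assert (HT : Rabs (Im s2 - Im s1) <= 4).
  { destruct H1 as (_ & H1), H2 as (_ & H2). apply Rabs_le_between in H1, H2.
    apply Rabs_le_between. lra. }
  destruct Hz as (Hz1 & Hz2), Hz' as (Hz1' & Hz2').
  destruct (fld_strip r r0 rge z Hz1 Hz2) as (A & _).
  destruct (fld_strip r r0 rge z' Hz1' Hz2') as (_ & B).
  destruct (p_strip r r0 rge z' Hz1' Hz2') as (_ & B').
  pose proof (P_pos r rge z Hz1 Hz2) as HP. pose proof (P_pos r rge z' Hz1' Hz2') as HP'.
  pose proof (P_le_const r rge z Hz1) as HPc. pose proof (P_le_const r rge z' Hz1') as HPc'.
  pose proof (Re_le (pfun r z)) as M1. pose proof (Cmod_le_sum (pfun r z')) as M2.
  rewrite (Rabs_pos_eq (Re (pfun r z'))) in M2 by lra.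
  rewrite <- Eu in A. rewrite <- Ev in B.
  apply Rabs_le_between in A. apply Rabs_le_between in B.
  set (P := Re (pfun r z)) in *. set (P' := Re (pfun r z')) in *.
  assert (Hv : 0.999 * P' <= v <= 1.001 * P') by lra.
  assert (HPsq : P ^ 2 <= / 5000 * / 5000) by nra.
  assert (HPsq0 : 0 < P ^ 2) by nra.
  assert (Hu : 0.332 * P ^ 2 <= u <= 0.3344 * P ^ 2) by lra.
  assert (Hu0 : 0 < u) by lra. assert (Hv0 : 0 < v) by lra.
  (* The segment may be long, but only in proportion to [1 / v]: [v |dx| = (v ^ 2 / u) |dy|], with
     quotient at most 3.2 and [|dy| <= 4]. This is what makes the Lipschitz bound on [1 / p]
     effective. *)
  assert (HS : v * Rabs (Re s2 - Re s1) <= 12.8).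
  { assert (K : u * Rabs (Re s2 - Re s1) = v * Rabs (Im s2 - Im s1)).
    { rewrite <- (Rabs_pos_eq u) at 1 by lra. rewrite <- (Rabs_pos_eq v) at 1 by lra.
      rewrite <- !Rabs_mult, <- E1, <- Rabs_Ropp. f_equal. ring. }
    apply Rmult_le_reg_l with u; [lra|].
    replace (u * (v * Rabs (Re s2 - Re s1))) with (v ^ 2 * Rabs (Im s2 - Im s1)) by (simpl; nra).
    pose proof (Rabs_pos (Im s2 - Im s1)). pose proof (pow2_ge_0 v).
    apply Rle_trans with (3.2 * u * 4); [|lra]. apply Rmult_le_compat; lra. }
  assert (HPP : 0.99 * P <= P').
  { pose proof (Cmod_sub_ge (/ pfun r z')%C (/ pfun r z)%C) as S.
    rewrite Cmod_minus_sym in L. rewrite !Cmod_inv in S by assumption.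
    rewrite Cmod_minus_sym in S.
    set (m := Cmod (pfun r z)) in *. set (m' := Cmod (pfun r z')) in *.
    assert (Hm' : 0 < m' <= 1.001 * P').
    { split; [apply Cmod_gt_0; exact N2|]. nra. }
    assert (Hm : 0 < m) by lra.
    rewrite Cmod_minus_sym in L.
    assert (S2 : / m' - / m <= 0.0003 * Cmod (z - z')%C).
    { eapply Rle_trans; [exact S|]. exact L. }
    assert (S3 : v * Cmod (z - z')%C <= 13).
    { apply Rle_trans with (v * (Rabs (Re s2 - Re s1) + 4)); [apply Rmult_le_compat_l; lra|]. lra. }
    (* The value is [0.0003 * 13]. Since [v] is comparable to the modulus of [p] at [z'], this is a
       relative bound: the moduli at [z] and [z'] differ by less than one per cent in the direction
       needed. *)
    assert (S4 : v * (/ m' - / m) <= 0.0039).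
    { apply Rle_trans with (v * (0.0003 * Cmod (z - z')%C)); [apply Rmult_le_compat_l; lra|]. lra. }
    assert (S5 : v * (m - m') <= 0.0039 * (m * m')).
    { replace (v * (m - m')) with (v * (/ m' - / m) * (m * m')) by (field; lra).
      apply Rmult_le_compat_r; [nra|exact S4]. }
    assert (S6 : 0.997 * m' <= v) by lra.
    assert (S7 : 0.993 * m <= m') .
    { destruct (Rle_dec m m') as [D|D]; [lra|].
      assert (0.997 * m' * (m - m') <= 0.0039 * (m * m')) by nra.
      apply Rmult_le_reg_l with m'; [lra|]. nra. }
    nra. }
  assert (HU : 2.9 * u <= v ^ 2).
  { assert (u <= 0.3344 * (P' / 0.99) ^ 2).
    { apply Rle_trans with (0.3344 * P ^ 2); [lra|]. apply Rmult_le_compat_l; [lra|].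
      apply pow_incr. lra. }
    assert ((0.999 * P') ^ 2 <= v ^ 2) by (apply pow_incr; lra). nra. }
  exists (v ^ 2 / u + u). split.
  { assert (2.9 <= v ^ 2 / u).
    { apply Rmult_le_reg_r with u; [lra|]. unfold Rdiv. rewrite Rmult_assoc, Rinv_l by lra. lra. }
    assert (v ^ 2 / u <= 3.2).
    { apply Rmult_le_reg_r with u; [lra|]. unfold Rdiv. rewrite Rmult_assoc, Rinv_l by lra. lra. }
    lra. }
  assert (ES : Re s2 - Re s1 = - (v / u) * (Im s2 - Im s1)).
  { apply Rmult_eq_reg_l with u; [|lra].
    replace (u * (- (v / u) * (Im s2 - Im s1))) with (- (v * (Im s2 - Im s1))) by (field; lra). lra. }
  split.
  - rewrite E2, ES. field. lra.
  - intros EI. rewrite EI in ES. replace (Im s2 - Im s2) with 0 in ES by ring.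
    rewrite Rmult_0_r in ES. clear -ES EI. destruct s1, s2. unfold Re, Im in *. simpl in *.
    f_equal; lra.
Qed.

Hypothesis Hlim : forall y eps, Rabs y <= 2 -> 0 < eps ->
    exists S, 0 <= S /\ forall x, S <= x -> Rabs (Re (F (x, y))) < eps.

Lemma Re_level_exists (x0 y x : R) : 0 <= x0 -> Rabs y <= 2 -> 0 < x < Re (F (x0, y)) ->
  exists x1, x0 <= x1 /\ Re (F (x1, y)) = x.
Proof.
  intros Hx0 Hy Hx.
  destruct (Hlim y x Hy) as (S & HS & HL); [lra|].
  set (b := Rmax S (x0 + 1)). pose proof (Rmax_l S (x0 + 1)) as M1. pose proof (Rmax_r S (x0 + 1)) as M2.
  fold b in M1, M2. specialize (HL b M1). apply Rabs_lt_between in HL.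
  set (g := fun t : R => Re (1 * F ((0, y) + RtoC t * 1))%C).
  assert (Eg : forall t, g t = Re (F (t, y))).
  { intros t. unfold g. rewrite Cmult_1_l. do 2 f_equal.
    unfold Cplus, Cmult, RtoC. simpl. f_equal; ring. }
  assert (Hcont : forall a, x0 <= a <= b -> continuity_pt (fun t => x - g t) a).
  { intros a Ha. apply continuity_pt_minus; [apply continuity_pt_const; intros ? ?; reflexivity|].
    apply derivable_continuous_pt. eexists. apply is_derive_Reals. unfold g.
    apply is_derive_segment, HF. unfold Re. simpl. lra. }
  destruct (Ranalysis5.IVT_interv (fun t => x - g t) x0 b) as (x1 & Hx1 & E); try assumption.
  - lra.
  - rewrite Eg. lra.
  - rewrite Eg. lra.
  - exists x1. rewrite <- Eg. split; lra.
Qed.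

(** The level set of [Re F] is followed from height [- 5/4] to [5/4]. By [level_set] the value of
    [Im F] drops along it by at least [2.9 * (5 / 2) > 2 * PI], hence meets every class modulo
    [2 * PI]. As [Re F] decreases in the height, [M] is the smallest value of [Re F] on the segment
    at abscissa [x0], so each smaller level is reached at every height to the right of it. *)
Lemma map_covers (x0 : R) : 0 <= x0 ->
  exists M, 0 < M /\ forall x y, 0 < x < M ->
    exists s (k : Z), x0 <= Re s /\ Rabs (Im s) <= 5 / 4 /\
      Re (F s) = x /\ Im (F s) = y + 2 * PI * IZR k.
Proof.
  intros Hx0. exists (Re (F (x0, 5 / 4))). split.
  { apply (Re_map_pos r r0 rge F HF Hlim). apply strip_pair; [exact Hx0|]. rewrite Rabs_pos_eq; lra. }
  intros x y Hx.
  (* Clamping the height makes the parametrisation total, so that continuity can be asserted on the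
     whole line before the intermediate value theorem is applied. *)
  set (cl := fun t : R => Rmax (- (5 / 4)) (Rmin t (5 / 4))).
  assert (Hcl : forall t, - (5 / 4) <= cl t <= 5 / 4).
  { intros t. unfold cl. split; [apply Rmax_l|]. apply Rmax_lub; [lra|apply Rmin_r]. }
  assert (Hcl2 : forall t, Rabs (cl t) <= 2).
  { intros t. specialize (Hcl t). apply Rabs_le_between. lra. }
  assert (Hclip : forall t t', Rabs (cl t - cl t') <= Rabs (t - t')).
  { intros t t'. unfold cl, Rmax, Rmin. repeat destruct Rle_dec; apply Rabs_le_between;
      unfold Rabs; destruct Rcase_abs; lra. }
  assert (HG : forall t, exists x1, x0 <= x1 /\ Re (F (x1, cl t)) = x).
  { intros t. apply Re_level_exists; [exact Hx0|apply Hcl2|]. split; [lra|].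
    eapply Rlt_le_trans; [apply Hx|].
    destruct (Re_vertical r F HF x0 (cl t) (5 / 4) Hx0 (Hcl2 t)) as (z & _ & Hz & E);
      [rewrite Rabs_pos_eq; lra|].
    pose proof (fld_im_pos r r0 rge z Hz). specialize (Hcl t). nra. }
  (* An arbitrary choice of a point at each height. No regularity of [G] enters: [level_set] makes
     [H] Lipschitz with constant 3.3 for any choice. *)
  set (G := fun t => proj1_sig (constructive_indefinite_description _ (HG t))).
  assert (HG1 : forall t, x0 <= G t /\ Re (F (G t, cl t)) = x).
  { intros t. exact (proj2_sig (constructive_indefinite_description _ (HG t))). }
  set (H := fun t => Im (F (G t, cl t))).
  assert (HH : forall t t', exists q, 2.9 <= q <= 3.3 /\ H t' - H t = - q * (cl t' - cl t)).
  { intros t t'. destruct (HG1 t) as (A1 & B1), (HG1 t') as (A2 & B2).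
    destruct (level_set (G t, cl t) (G t', cl t')) as (q & Hq & E & _).
    - apply strip_pair; [lra|apply Hcl2].
    - apply strip_pair; [lra|apply Hcl2].
    - rewrite B1, B2. reflexivity.
    - exists q. split; [exact Hq|exact E]. }
  assert (Hcont : continuity H).
  { intros t. apply continuity_pt_filterlim. apply (continuous_lipschitz H t 3.3 1); [lra|].
    intros h _. destruct (HH t (t + h)) as (q & Hq & E). rewrite E.
    rewrite Rabs_mult, Rabs_Ropp, (Rabs_pos_eq q) by lra.
    pose proof (Hclip (t + h) t) as L. replace (t + h - t) with h in L by ring.
    pose proof (Rabs_pos (cl (t + h) - cl t)). nra. }
  assert (C1 : cl (- (5 / 4)) = - (5 / 4)).
  { unfold cl. rewrite Rmin_left by lra. apply Rmax_left. lra. }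
  assert (C2 : cl (5 / 4) = 5 / 4).
  { unfold cl. rewrite Rmin_left by lra. apply Rmax_right. lra. }
  assert (Hlen : H (5 / 4) + 2 * PI < H (- (5 / 4))).
  { destruct (HH (- (5 / 4)) (5 / 4)) as (q & Hq & E). rewrite C1, C2 in E. pose proof PI_lt. lra. }
  pose proof PI_RGT_0 as HPI.
  (* The least [k] with [y + 2 * PI * k] strictly above the value at the lower end of the range of
     [H]; it overshoots by at most [2 * PI] and so stays below the upper end. *)
  set (k := up ((H (5 / 4) - y) / (2 * PI))).
  destruct (archimed ((H (5 / 4) - y) / (2 * PI))) as (K1 & K2). fold k in K1, K2.
  set (w := y + 2 * PI * IZR k).
  assert (W1 : H (5 / 4) < w).
  { apply (Rmult_lt_compat_r (2 * PI)) in K1; [|lra].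
    unfold Rdiv in K1. rewrite Rmult_assoc, Rinv_l, Rmult_1_r in K1 by lra. unfold w. lra. }
  assert (W2 : w <= H (5 / 4) + 2 * PI).
  { apply (Rmult_le_compat_r (2 * PI)) in K2; [|lra].
    rewrite Rmult_minus_distr_r in K2.
    unfold Rdiv in K2. rewrite Rmult_assoc, Rinv_l, Rmult_1_r in K2 by lra. unfold w. lra. }
  destruct (Ranalysis5.IVT_interv (fun t => w - H t) (- (5 / 4)) (5 / 4)) as (t & Ht & E).
  - intros a _. apply continuity_pt_minus; [apply continuity_pt_const; intros ? ?; reflexivity|apply Hcont].
  - lra.
  - lra.
  - lra.
  - exists (G t, cl t), k. destruct (HG1 t) as (A1 & B1).
    split; [exact A1|]. split; [apply Rabs_le_between; apply Hcl|]. split; [exact B1|].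
    change (H t = w). lra.
Qed.

End Level.

(** * Exponential and logarithm *)

Definition cexp (s : C) : C := (exp (Re s) * cos (Im s), exp (Re s) * sin (Im s)).

Lemma cexp_plus a b : cexp (a + b)%C = (cexp a * cexp b)%C.
Proof.
  destruct a as [x y], b as [u v]. unfold cexp, Cmult, Re, Im. simpl.
  rewrite exp_plus, cos_plus, sin_plus. f_equal; ring.
Qed.

Lemma Cmod_cexp s : Cmod (cexp s) = exp (Re s).
Proof.
  destruct s as [x y]. unfold cexp, Cmod, Re, Im. simpl.
  replace (exp x * cos y * (exp x * cos y * 1) + exp x * sin y * (exp x * sin y * 1))
    with (exp x * exp x * ((sin y)² + (cos y)²)) by (unfold Rsqr; ring).
  rewrite sin2_cos2, Rmult_1_r. apply sqrt_square. left. apply exp_pos.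
Qed.

Lemma Rabs_sin_le y : Rabs (sin y) <= Rabs y.
Proof.
  destruct (MVT_gen sin 0 y cos) as (c & _ & E).
  - intros x _. apply is_derive_Reals, derivable_pt_lim_sin.
  - intros x _. apply continuity_sin.
  - rewrite sin_0, !Rminus_0_r in E. rewrite E, Rabs_mult.
    assert (Rabs (cos c) <= 1) by (apply Rabs_le_between, COS_bound).
    pose proof (Rabs_pos y). nra.
Qed.

Lemma one_minus_cos y : 0 <= 1 - cos y <= y ^ 2 / 2.
Proof.
  split; [pose proof (COS_bound y); lra|].
  replace y with (2 * (y / 2)) at 1 by field. rewrite cos_2a_sin.
  pose proof (Rabs_sin_le (y / 2)) as H. apply (fun H => pow_incr _ _ 2 (conj (Rabs_pos _) H)) in H.
  rewrite !pow2_abs in H. lra.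
Qed.

Lemma sin_minus_id y : Rabs y <= 1 -> Rabs (sin y - y) <= y ^ 2 / 2.
Proof.
  intros Hy. destruct (MVT_gen sin 0 y cos) as (c & Hc & E).
  - intros x _. apply is_derive_Reals, derivable_pt_lim_sin.
  - intros x _. apply continuity_sin.
  - rewrite sin_0, !Rminus_0_r in E. rewrite E.
    replace (cos c * y - y) with (- ((1 - cos c) * y)) by ring.
    rewrite Rabs_Ropp, Rabs_mult. pose proof (one_minus_cos c) as H.
    rewrite (Rabs_pos_eq (1 - cos c)) by lra.
    assert (Hcy : Rabs c <= Rabs y).
    { unfold Rmin, Rmax in Hc. destruct (Rle_dec 0 y); [rewrite !Rabs_pos_eq by lra; lra|].
      rewrite !Rabs_left1 by lra. lra. }
    assert (c ^ 2 <= y ^ 2).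
    { rewrite <- (pow2_abs c), <- (pow2_abs y). apply pow_incr. split; [apply Rabs_pos|exact Hcy]. }
    pose proof (Rabs_pos y). pose proof (pow2_ge_0 y). nra.
Qed.

Lemma exp_quad x : Rabs x <= 1 / 2 -> Rabs (exp x - 1 - x) <= 2 * x ^ 2.
Proof.
  intros Hx. apply Rabs_le_between in Hx.
  pose proof (exp_ineq1_le x). pose proof (exp_ineq1_le (- x)) as H1. rewrite exp_Ropp in H1.
  pose proof (exp_pos x) as Hp.
  assert (exp x * (1 - x) <= 1).
  { apply Rle_trans with (exp x * / exp x); [apply Rmult_le_compat_l; lra|]. rewrite Rinv_r; lra. }
  rewrite Rabs_pos_eq by lra. nra.
Qed.

(** For [w = x + i y] the remainder splits as [e^(iy) (e^x - 1 - x) + (1 + x) (e^(iy) - 1 - i y) + i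
    x y], which reduces it to real estimates. *)
Lemma cexp_quad (w : C) : Cmod w <= 1 / 2 -> Cmod (cexp w - 1 - w)%C <= 4 * Cmod w ^ 2.
Proof.
  intros Hw. pose proof (re_le_Cmod w) as Hx. pose proof (im_le_Cmod w) as Hy.
  rewrite Cmod2_alt.
  assert (H0 : cexp (RtoC (Im w) * Ci)%C = (cos (Im w), sin (Im w))).
  { unfold cexp. replace (Re (RtoC (Im w) * Ci)%C) with 0 by (unfold Re; simpl; ring).
    replace (Im (RtoC (Im w) * Ci)%C) with (Im w) by (unfold Im; simpl; ring).
    rewrite exp_0, !Rmult_1_l. reflexivity. }
  assert (H1 : Cmod (cexp (RtoC (Im w) * Ci)%C) = 1).
  { rewrite Cmod_cexp. unfold Re. simpl. rewrite <- exp_0. f_equal. ring. }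
  replace (cexp w - 1 - w)%C with (RtoC (exp (Re w) - 1 - Re w) * cexp (RtoC (Im w) * Ci)
    + (RtoC (1 + Re w) * (cos (Im w) - 1, sin (Im w) - Im w)%R + RtoC (Re w * Im w) * Ci))%C.
  2:{ rewrite H0. destruct w as [x y]. unfold cexp, Re, Im.
      apply injective_projections; simpl; ring. }
  pose proof (exp_quad (Re w) ltac:(lra)) as H2.
  pose proof (one_minus_cos (Im w)) as H3. pose proof (sin_minus_id (Im w) ltac:(lra)) as H4.
  assert (H5 : Cmod (cos (Im w) - 1, sin (Im w) - Im w) <= Im w ^ 2).
  { clear -H3 H4. set (y := Im w) in *. clearbody y.
    eapply Rle_trans; [apply Cmod_le_sum|]. unfold Re, Im. cbn [fst snd].
    rewrite Rabs_left1 by lra. lra. }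
  eapply Rle_trans; [apply Cmod_triangle|]. rewrite Cmod_mult, H1, Cmod_R, Rmult_1_r.
  set (T := Cmod (RtoC (1 + Re w) * (cos (Im w) - 1, sin (Im w) - Im w)%R + RtoC (Re w * Im w) * Ci)%C).
  assert (HT : T <= 3 / 2 * Im w ^ 2 + Rabs (Re w * Im w)).
  { unfold T. eapply Rle_trans; [apply Cmod_triangle|]. rewrite !Cmod_mult, Cmod_Ci, !Cmod_R, Rmult_1_r.
    apply Rplus_le_compat_r. apply Rmult_le_compat; try apply Rabs_pos; try apply Cmod_ge_0; [|exact H5].
    apply Rabs_le_between in Hx. apply Rabs_le_between. lra. }
  assert (Rabs (Re w * Im w) <= (Re w ^ 2 + Im w ^ 2) / 2).
  { pose proof (pow2_ge_0 (Re w - Im w)). pose proof (pow2_ge_0 (Re w + Im w)).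
    apply Rabs_le_between. lra. }
  pose proof (pow2_ge_0 (Re w)). pose proof (pow2_ge_0 (Im w)). lra.
Qed.

Lemma cexp_cderiv z : cderiv cexp z (cexp z).
Proof.
  exists (4 * Cmod (cexp z)), (1 / 2). pose proof (Cmod_ge_0 (cexp z)).
  split; [lra|]. split; [lra|]. intros w Hw. rewrite cexp_plus.
  replace (cexp z * cexp w - cexp z - cexp z * w)%C with (cexp z * (cexp w - 1 - w))%C by ring.
  rewrite Cmod_mult. pose proof (cexp_quad w ltac:(lra)). nra.
Qed.

(** The principal logarithm on the right half-plane, where [atan (Im u / Re u)] is the argument. *)
Definition clog (u : C) : C := (ln (Cmod u), atan (Im u / Re u)).

Lemma cexp_clog u : 0 < Re u -> cexp (clog u) = u.
Proof.
  intros Hu. assert (Hm : 0 < Cmod u) by (pose proof (Re_le u); lra).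
  change ((exp (ln (Cmod u)) * cos (atan (Im u / Re u)), exp (ln (Cmod u)) * sin (atan (Im u / Re u))) = u).
  rewrite exp_ln by exact Hm. rewrite cos_atan, sin_atan.
  assert (E : sqrt (1 + (Im u / Re u)²) = Cmod u / Re u).
  { replace (1 + (Im u / Re u)²) with ((Cmod u / Re u) ^ 2).
    - apply sqrt_pow2. apply Rlt_le, Rdiv_lt_0_compat; assumption.
    - unfold Rdiv. rewrite Rpow_mult_distr, Cmod2_alt. unfold Rsqr. field. lra. }
  rewrite E. apply injective_projections; cbn [fst snd]; unfold Re, Im in *; field; lra.
Qed.

Lemma clog_im u : - (PI / 2) < Im (clog u) < PI / 2.
Proof. unfold clog, Im. simpl. pose proof (atan_bound (snd u / Re u)). lra. Qed.

Lemma clog_cexp s : - (PI / 2) < Im s < PI / 2 -> clog (cexp s) = s.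
Proof.
  intros Hs. unfold clog. rewrite Cmod_cexp, ln_exp.
  change (Im (cexp s) / Re (cexp s)) with (exp (Re s) * sin (Im s) / (exp (Re s) * cos (Im s))).
  assert (Hc : 0 < cos (Im s)) by (apply cos_gt_0; lra). pose proof (exp_pos (Re s)).
  replace (exp (Re s) * sin (Im s) / (exp (Re s) * cos (Im s))) with (tan (Im s))
    by (unfold tan; field; lra).
  rewrite atan_tan by lra. destruct s. reflexivity.
Qed.

Lemma ln_sub_le a b : 0 < a -> 0 < b -> ln a - ln b <= (a - b) / b.
Proof.
  intros Ha Hb. rewrite <- ln_div by assumption.
  replace ((a - b) / b) with (a / b - 1) by (field; lra).
  assert (0 < a / b) by (apply Rdiv_lt_0_compat; assumption).
  pose proof (exp_ineq1_le (ln (a / b))) as E. rewrite exp_ln in E by assumption. lra.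
Qed.

Lemma atan_lip a b : Rabs (atan a - atan b) <= Rabs (a - b).
Proof.
  destruct (MVT_gen atan b a (fun x => / (1 + x ^ 2))) as (c & _ & E).
  - intros x _. apply is_derive_Reals, derivable_pt_lim_atan.
  - intros x _. apply derivable_continuous_pt, derivable_pt_atan.
  - rewrite E, Rabs_mult.
    assert (Rabs (/ (1 + c ^ 2)) <= 1).
    { pose proof (pow2_ge_0 c). rewrite Rabs_pos_eq by (apply Rlt_le, Rinv_0_lt_compat; lra).
      rewrite <- Rinv_1. apply Rinv_le_contravar; lra. }
    pose proof (Rabs_pos (a - b)). nra.
Qed.

Lemma clog_lip u : 0 < Re u -> exists M, 0 <= M /\ forall w, Cmod w < Re u / 2 ->
  Cmod (clog (u + w) - clog u)%C <= M * Cmod w.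
Proof.
  intros Hu. pose proof (Re_le u) as Hm. set (m := Cmod u) in *. set (x := Re u) in *.
  assert (Hi : 0 < / (x * (x / 2))) by (apply Rinv_0_lt_compat; nra).
  assert (Hi2 : 0 < / (m / 2)) by (apply Rinv_0_lt_compat; lra).
  exists (/ (m / 2) + 2 * m * / (x * (x / 2))). split; [nra|].
  intros w Hw. pose proof (re_le_Cmod w) as R1. pose proof (im_le_Cmod w) as R2.
  pose proof (Cmod_ge_0 w) as W0.
  assert (Hb : m / 2 <= Cmod (u + w)%C).
  { pose proof (Cmod_sub_ge u (- w)%C) as H. rewrite Cmod_opp in H. fold m in H.
    replace (u - - w)%C with (u + w)%C in H by ring. lra. }
  assert (Hd1 : Cmod (u + w)%C - m <= Cmod w) by (pose proof (Cmod_triangle u w) as H; fold m in H; lra).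
  assert (Hd2 : m - Cmod (u + w)%C <= Cmod w).
  { pose proof (Cmod_sub_ge u (- w)%C) as H. rewrite Cmod_opp in H. fold m in H.
    replace (u - - w)%C with (u + w)%C in H by ring. lra. }
  eapply Rle_trans; [apply Cmod_le_sum|].
  replace (Re (clog (u + w) - clog u)%C) with (ln (Cmod (u + w)%C) - ln m) by reflexivity.
  replace (Im (clog (u + w) - clog u)%C) with (atan (Im (u + w)%C / Re (u + w)%C) - atan (Im u / x))
    by reflexivity.
  rewrite Rmult_plus_distr_r. apply Rplus_le_compat.
  - apply Rabs_le_between. split.
    + pose proof (ln_sub_le m (Cmod (u + w)%C) ltac:(lra) ltac:(lra)) as L.
      assert ((m - Cmod (u + w)%C) / Cmod (u + w)%C <= / (m / 2) * Cmod w); [|lra].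
      apply Rle_trans with (Cmod w * / Cmod (u + w)%C).
      * apply Rmult_le_compat_r; [left; apply Rinv_0_lt_compat; lra|lra].
      * rewrite Rmult_comm. apply Rmult_le_compat_r; [lra|]. apply Rinv_le_contravar; lra.
    + pose proof (ln_sub_le (Cmod (u + w)%C) m ltac:(lra) ltac:(lra)) as L.
      assert ((Cmod (u + w)%C - m) / m <= / (m / 2) * Cmod w); [|lra].
      apply Rle_trans with (Cmod w * / m).
      * apply Rmult_le_compat_r; [left; apply Rinv_0_lt_compat; lra|lra].
      * rewrite Rmult_comm. apply Rmult_le_compat_r; [lra|]. apply Rinv_le_contravar; lra.
  - eapply Rle_trans; [apply atan_lip|].
    pose proof (im_le_Cmod u) as I1. fold m in I1.
    assert (Hx : x / 2 <= Re (u + w)%C).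
    { replace (Re (u + w)%C) with (x + Re w) by reflexivity. apply Rabs_le_between in R1. lra. }
    replace (Im (u + w)%C / Re (u + w)%C - Im u / x)
      with ((Im w * x - Im u * Re w) * / (x * Re (u + w)%C)).
    2:{ replace (Im (u + w)%C) with (Im u + Im w) by reflexivity.
        replace (Re (u + w)%C) with (x + Re w) in * by reflexivity. field. lra. }
    rewrite Rabs_mult. rewrite (Rabs_pos_eq (/ _)) by (left; apply Rinv_0_lt_compat; nra).
    replace (2 * m * / (x * (x / 2)) * Cmod w) with (2 * m * Cmod w * / (x * (x / 2))) by ring.
    apply Rmult_le_compat; [apply Rabs_pos|left; apply Rinv_0_lt_compat; nra| |].
    + unfold Rminus. eapply Rle_trans; [apply Rabs_triang|]. rewrite Rabs_Ropp, !Rabs_mult.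
      rewrite (Rabs_pos_eq x) by lra.
      assert (Rabs (Im w) * x <= Cmod w * m) by (apply Rmult_le_compat; try apply Rabs_pos; lra).
      assert (Rabs (Im u) * Rabs (Re w) <= m * Cmod w) by (apply Rmult_le_compat; try apply Rabs_pos; lra).
      lra.
    + apply Rinv_le_contravar; [nra|]. apply Rmult_le_compat_l; lra.
Qed.

(** The increment [v] of the logarithm satisfies [cexp v = 1 + w / u], so [cexp_quad] gives
    [|w / u - v| <= 4 |v| ^ 2]. The Lipschitz bound then replaces [|v|] by a multiple of [|w|]. *)
Lemma clog_cderiv u : 0 < Re u -> cderiv clog u (/ u)%C.
Proof.
  intros Hu. destruct (clog_lip u Hu) as (M & HM & HL).
  assert (Hn : u <> 0%C) by (apply Cmod_gt_0; pose proof (Re_le u); lra).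
  exists (4 * M ^ 2), (Rmin (Re u / 2) (/ (2 * (M + 1)))).
  split; [nra|]. split; [apply Rmin_pos; [lra|apply Rinv_0_lt_compat; lra]|].
  intros w Hw. pose proof (Rmin_l (Re u / 2) (/ (2 * (M + 1)))) as M1.
  pose proof (Rmin_r (Re u / 2) (/ (2 * (M + 1)))) as M2.
  assert (W1 : Cmod w < Re u / 2) by lra. assert (W2 : Cmod w < / (2 * (M + 1))) by lra.
  specialize (HL w W1). pose proof (Cmod_ge_0 w).
  assert (Huw : 0 < Re (u + w)%C).
  { pose proof (re_le_Cmod w) as R. apply Rabs_le_between in R.
    replace (Re (u + w)%C) with (Re u + Re w) by reflexivity. lra. }
  set (v := (clog (u + w) - clog u)%C) in *.
  assert (Ev : cexp v = (1 + / u * w)%C).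
  { assert (E : (cexp v * cexp (clog u))%C = cexp (clog (u + w))%C).
    { rewrite <- cexp_plus. f_equal. unfold v. ring. }
    rewrite !cexp_clog in E by assumption.
    replace (cexp v) with (cexp v * u * / u)%C by (field; exact Hn). rewrite E. field. exact Hn. }
  assert (Hv : Cmod v <= 1 / 2).
  { apply Rle_trans with ((M + 1) * / (2 * (M + 1))).
    - eapply Rle_trans; [exact HL|]. apply Rmult_le_compat; lra.
    - apply Req_le. field. lra. }
  pose proof (cexp_quad v Hv) as Q. rewrite Ev in Q.
  replace (1 + / u * w - 1 - v)%C with (/ u * w - v)%C in Q by ring.
  rewrite Cmod_minus_sym in Q. eapply Rle_trans; [exact Q|].
  assert (Cmod v ^ 2 <= (M * Cmod w) ^ 2) by (apply pow_incr; split; [apply Cmod_ge_0|exact HL]).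
  nra.
Qed.

(** The half-angle formulas give the moduli of both coordinates. The root is taken in the closed
    right half-plane because [moeb_surj] is stated there. *)
Lemma csqrt_exists (w : C) : exists v : C, (v * v)%C = w /\ 0 <= Re v.
Proof.
  pose proof (re_le_Cmod w) as Hx. apply Rabs_le_between in Hx.
  pose proof (Cmod2_alt w) as E. set (m := Cmod w) in *.
  set (p := sqrt ((m + Re w) / 2)). set (q := sqrt ((m - Re w) / 2)).
  assert (Hp : p * p = (m + Re w) / 2) by (apply sqrt_sqrt; lra).
  assert (Hq : q * q = (m - Re w) / 2) by (apply sqrt_sqrt; lra).
  assert (Hp0 : 0 <= p) by apply sqrt_pos. assert (Hq0 : 0 <= q) by apply sqrt_pos.
  assert (Hpq : (2 * (p * q)) ^ 2 = Im w ^ 2).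
  { replace ((2 * (p * q)) ^ 2) with (4 * (p * p) * (q * q)) by ring. rewrite Hp, Hq. simpl in *. nra. }
  destruct (Rle_dec 0 (Im w)) as [H|H].
  - exists (p, q). split; [|exact Hp0].
    assert (2 * (p * q) = Im w).
    { apply Rsqr_inj; [nra|exact H|]. unfold Rsqr. simpl in Hpq. lra. }
    destruct w as [a b]. unfold Re, Im, Cmult in *. simpl in *. f_equal; lra.
  - exists (p, - q). split; [|exact Hp0].
    assert (2 * (p * q) = - Im w).
    { apply Rsqr_inj; [nra|lra|]. unfold Rsqr. simpl in Hpq. lra. }
    destruct w as [a b]. unfold Re, Im, Cmult in *. simpl in *. f_equal; lra.
Qed.

Lemma polar_exists (z : C) : z <> 0%C -> exists y, z = cexp (ln (Cmod z), y).
Proof.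
  intros Hz. apply Cmod_gt_0 in Hz. pose proof (Cmod2_alt z) as E.
  pose proof (re_le_Cmod z) as Hx. apply Rabs_le_between in Hx.
  set (m := Cmod z) in *. set (c := Re z / m).
  assert (Hc : -1 <= c <= 1).
  { unfold c. split.
    - apply Rmult_le_reg_r with m; [lra|]. unfold Rdiv. rewrite Rmult_assoc, Rinv_l by lra. lra.
    - apply Rmult_le_reg_r with m; [lra|]. unfold Rdiv. rewrite Rmult_assoc, Rinv_l by lra. lra. }
  assert (Hs : m * sqrt (1 - c²) = Rabs (Im z)).
  { apply Rsqr_inj; [apply Rmult_le_pos; [lra|apply sqrt_pos]|apply Rabs_pos|].
    rewrite Rsqr_mult, Rsqr_sqrt, <- Rsqr_abs.
    - unfold c, Rsqr. field_simplify; [|lra]. simpl in *. lra.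
    - unfold Rsqr. nra. }
  assert (Hre : m * c = Re z) by (unfold c; field; lra).
  destruct (Rle_dec 0 (Im z)) as [H|H].
  - exists (acos c). unfold cexp. unfold Re, Im. simpl. rewrite exp_ln by exact Hz.
    rewrite cos_acos, sin_acos by exact Hc. rewrite Hre, Hs, Rabs_pos_eq by exact H.
    destruct z. reflexivity.
  - exists (- acos c). unfold cexp. unfold Re, Im. simpl. rewrite exp_ln by exact Hz.
    rewrite cos_neg, sin_neg, cos_acos, sin_acos by exact Hc.
    replace (m * - sqrt (1 - c²)) with (- (m * sqrt (1 - c²))) by ring.
    rewrite Hre, Hs, Rabs_left by lra. destruct z. unfold Re, Im. simpl. f_equal; lra.
Qed.

Lemma cexp_period_nat x y (k : nat) : cexp (x, y + 2 * PI * INR k) = cexp (x, y).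
Proof.
  unfold cexp, Re, Im. simpl. replace (2 * PI * INR k) with (2 * INR k * PI) by ring.
  rewrite cos_period, sin_period. reflexivity.
Qed.

Lemma cexp_period x y (k : Z) : cexp (x, y + 2 * PI * IZR k) = cexp (x, y).
Proof.
  destruct (Z.le_gt_cases 0 k) as [H|H].
  - rewrite <- (Z2Nat.id k H), <- INR_IZR_INZ. apply cexp_period_nat.
  - rewrite <- (cexp_period_nat x (y + 2 * PI * IZR k) (Z.to_nat (- k))).
    rewrite INR_IZR_INZ, Z2Nat.id by lia. rewrite opp_IZR. f_equal. f_equal. ring.
Qed.

Lemma cos_eq_1_small d : cos d = 1 -> Rabs d < 4 * PI -> d = 0 \/ d = 2 * PI \/ d = - (2 * PI).
Proof.
  intros Hc Hd. apply Rabs_lt_between in Hd. pose proof PI_RGT_0 as HPI.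
  assert (S : sin (d / 2) = 0).
  { replace d with (2 * (d / 2)) in Hc by field. rewrite cos_2a_sin in Hc. nra. }
  apply sin_eq_0_0 in S. destruct S as (k & Hk).
  assert (-2 < IZR k < 2) as (K1 & K2) by (split; apply Rmult_lt_reg_r with PI; lra).
  apply lt_IZR in K1, K2. assert (k = 0 \/ k = 1 \/ k = -1)%Z as [ -> | [ -> | -> ] ] by lia; lra.
Qed.

Lemma cexp_eq a b : cexp a = cexp b -> Rabs (Im a - Im b) < 4 * PI ->
  Re a = Re b /\ (Im a - Im b = 0 \/ Im a - Im b = 2 * PI \/ Im a - Im b = - (2 * PI)).
Proof.
  intros E Hd. assert (ER : Re a = Re b).
  { apply exp_inv. rewrite <- !Cmod_cexp, E. reflexivity. }
  split; [exact ER|]. apply cos_eq_1_small; [|exact Hd].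
  unfold cexp in E. rewrite ER in E. injection E. intros E1 E2.
  pose proof (exp_pos (Re b)). apply Rmult_eq_reg_l in E1; [|lra]. apply Rmult_eq_reg_l in E2; [|lra].
  rewrite cos_minus, E1, E2. pose proof (sin2_cos2 (Im b)) as H1. unfold Rsqr in H1. lra.
Qed.

(** * The logarithmic chart of the disc and Moebius maps *)

(** The point 1 goes to the infinite end of the strip. The factor 1/2 normalises
    [Cmod (1 - z) <= 2], so that the image of the disc has nonnegative real part. *)
Definition slog (z : C) : C := (- clog (RtoC (/ 2) * (1 - z)))%C.

Lemma slog_dom z : Re z < 1 -> 0 < Re (RtoC (/ 2) * (1 - z))%C.
Proof. intros H. destruct z. unfold Re in *. simpl in *. lra. Qed.

Lemma cexp_slog z : Re z < 1 -> (1 - RtoC 2 * cexp (- slog z))%C = z.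
Proof.
  intros H. unfold slog.
  replace (- - clog (RtoC (/ 2) * (1 - z)))%C with (clog (RtoC (/ 2) * (1 - z))) by ring.
  rewrite cexp_clog by (apply slog_dom, H).
  rewrite RtoC_inv by lra. field.
Qed.

Lemma slog_inj z z' : Re z < 1 -> Re z' < 1 -> slog z = slog z' -> z = z'.
Proof. intros H H' E. rewrite <- (cexp_slog z H), <- (cexp_slog z' H'), E. reflexivity. Qed.

Lemma slog_im z : - (PI / 2) < Im (slog z) < PI / 2.
Proof.
  unfold slog. pose proof (clog_im (RtoC (/ 2) * (1 - z))%C) as H. revert H.
  generalize (clog (RtoC (/ 2) * (1 - z))). intros [a b]. unfold Im. simpl. lra.
Qed.

Lemma slog_re z : Re z < 1 -> exp (- Re (slog z)) = Cmod (1 - z)%C / 2.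
Proof.
  intros H.
  replace (- Re (slog z)) with (Re (- slog z)%C) by (destruct (slog z); reflexivity).
  rewrite <- Cmod_cexp. unfold slog.
  replace (- - clog (RtoC (/ 2) * (1 - z)))%C with (clog (RtoC (/ 2) * (1 - z))) by ring.
  rewrite cexp_clog by (apply slog_dom, H). rewrite Cmod_mult, Cmod_R, Rabs_pos_eq by lra. lra.
Qed.

Lemma slog_strip z : Re z < 1 -> Cmod z <= 1 -> strip (slog z).
Proof.
  intros H Hz. split.
  - pose proof (slog_re z H) as E. pose proof (Cmod_minus_triangle 1 z) as T. rewrite Cmod_1 in T.
    destruct (Rle_dec 0 (Re (slog z))) as [R|R]; [exact R|exfalso].
    pose proof (exp_increasing 0 (- Re (slog z)) ltac:(lra)) as I. rewrite exp_0 in I. lra.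
  - pose proof (slog_im z). pose proof PI_4. apply Rabs_le_between. lra.
Qed.

Lemma slog_cderiv z : Re z < 1 -> exists l, cderiv slog z l.
Proof.
  intros H. eexists.
  apply cderiv_ext with (fun x => RtoC (-1) * clog (RtoC (/ 2) * (RtoC 1 + RtoC (-1) * x)))%C.
  - intros x. unfold slog. replace (RtoC 1 + RtoC (-1) * x)%C with (1 - x)%C.
    + replace (RtoC (-1)) with (- (1))%C by (apply injective_projections; simpl; ring). ring.
    + replace (RtoC (-1)) with (- (1))%C by (apply injective_projections; simpl; ring). ring.
  - apply cderiv_scal.
    apply (cderiv_comp clog (fun x => RtoC (/ 2) * (RtoC 1 + RtoC (-1) * x))%C).
    + apply cderiv_scal. apply cderiv_plus; [apply cderiv_const|]. apply cderiv_scal, cderiv_id.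
    + apply clog_cderiv. replace (RtoC 1 + RtoC (-1) * z)%C with (1 - z)%C.
      * apply slog_dom, H.
      * replace (RtoC (-1)) with (- (1))%C by (apply injective_projections; simpl; ring). ring.
Qed.

Lemma Cmod_lt_1_sq z : Cmod z < 1 <-> Re z ^ 2 + Im z ^ 2 < 1.
Proof.
  rewrite <- Cmod2_alt. pose proof (Cmod_ge_0 z). split; intros; nra.
Qed.

(** With [e = exp (- Re s)], the preimage [1 - 2 exp (- s)] has squared modulus
    [1 - 4 e cos (Im s) + 4 e ^ 2], which is below 1 exactly when [e < cos (Im s)]. As
    [5/4 < PI / 2], the principal logarithm returns [s] itself. *)
Lemma slog_surj s : Rabs (Im s) <= 5 / 4 -> exp (- Re s) < cos (Im s) ->
  exists z, Cmod z < 1 /\ slog z = s.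
Proof.
  intros Hi Hc. exists (1 - RtoC 2 * cexp (- s))%C. split.
  - apply Cmod_lt_1_sq. pose proof (exp_pos (- Re s)) as Hp.
    pose proof (sin2_cos2 (Im s)) as T. unfold Rsqr in T.
    assert (E1 : Re (1 - RtoC 2 * cexp (- s))%C = 1 - 2 * (exp (- Re s) * cos (Im s))).
    { rewrite <- (cos_neg (Im s)). destruct s. unfold cexp, Re, Im. simpl. ring. }
    assert (E2 : Im (1 - RtoC 2 * cexp (- s))%C = 2 * (exp (- Re s) * sin (Im s))).
    { replace (sin (Im s)) with (- sin (- Im s)) by (rewrite sin_neg; ring).
      destruct s. unfold cexp, Re, Im. simpl. ring. }
    rewrite E1, E2. set (e := exp (- Re s)) in *. set (c := cos (Im s)) in *. set (d := sin (Im s)) in *.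
    replace ((1 - 2 * (e * c)) ^ 2 + (2 * (e * d)) ^ 2) with (1 - 4 * e * c + 4 * (e * e) * (d * d + c * c)) by ring.
    rewrite T. nra.
  - unfold slog. replace (1 - (1 - RtoC 2 * cexp (- s)))%C with (RtoC 2 * cexp (- s))%C by ring.
    replace (RtoC (/ 2) * (RtoC 2 * cexp (- s)))%C with (cexp (- s)).
    + rewrite clog_cexp; [ring|]. replace (Im (- s)%C) with (- Im s) by (destruct s; reflexivity).
      apply Rabs_le_between in Hi. pose proof PI2_3_2. lra.
    + rewrite Cmult_assoc, <- RtoC_mult. replace (/ 2 * 2) with 1 by field. ring.
Qed.

Definition moeb (a : R) (x : C) : C := ((x - RtoC a) / (1 - RtoC a * x))%C.

Section Moebius.
Variable a : R.
Hypothesis Ha : 0 < a < 1.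

Lemma moeb_den x : Cmod x < 1 -> (1 - RtoC a * x)%C <> 0%C.
Proof.
  intros Hx. apply Cmod_gt_0. pose proof (Cmod_sub_ge 1 (RtoC a * x)%C) as H.
  rewrite Cmod_1, Cmod_mult, Cmod_R, Rabs_pos_eq in H by lra. pose proof (Cmod_ge_0 x). nra.
Qed.

Lemma moeb_den_le x : Cmod x < 1 -> Cmod (1 - RtoC a * x)%C <= 1 + a.
Proof.
  intros Hx. eapply Rle_trans; [apply Cmod_minus_triangle|].
  rewrite Cmod_1, Cmod_mult, Cmod_R, Rabs_pos_eq by lra. pose proof (Cmod_ge_0 x). nra.
Qed.

Lemma moeb_identity x : Cmod x < 1 ->
  (1 - Cmod (moeb a x) ^ 2) * Cmod (1 - RtoC a * x)%C ^ 2 = (1 - a ^ 2) * (1 - Cmod x ^ 2).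
Proof.
  intros Hx. pose proof (moeb_den x Hx) as N. unfold moeb. rewrite Cmod_div by exact N.
  apply Cmod_gt_0 in N.
  replace ((1 - (Cmod (x - RtoC a)%C / Cmod (1 - RtoC a * x)%C) ^ 2) * Cmod (1 - RtoC a * x)%C ^ 2)
    with (Cmod (1 - RtoC a * x)%C ^ 2 - Cmod (x - RtoC a)%C ^ 2) by (field; lra).
  rewrite !Cmod2_alt. destruct x. unfold Re, Im. simpl. ring.
Qed.

Lemma moeb_lt_1 x : Cmod x < 1 -> Cmod (moeb a x) < 1.
Proof.
  intros Hx. pose proof (moeb_identity x Hx) as E. pose proof (Cmod_ge_0 x) as X0.
  pose proof (moeb_den x Hx) as N. apply Cmod_gt_0 in N. pose proof (Cmod_ge_0 (moeb a x)).
  destruct (Rlt_le_dec (Cmod (moeb a x)) 1) as [L|L]; [exact L|exfalso].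
  assert (0 < (1 - a ^ 2) * (1 - Cmod x ^ 2)) by (apply Rmult_lt_0_compat; nra).
  assert (0 < Cmod (1 - RtoC a * x)%C ^ 2) by (apply pow_lt; exact N).
  assert (1 <= Cmod (moeb a x) ^ 2) by nra. nra.
Qed.

(** Follows from [moeb_identity] and [Cmod (1 - a x) <= 1 + a]. A Moebius map shrinks the defect
    [1 - |x| ^ 2] at most by the factor [(1 - a) / (1 + a)]; this transfers boundary estimates from
    [phi] to [psi]. *)
Lemma moeb_defect x : Cmod x < 1 ->
  (1 - a) * (1 - Cmod x ^ 2) <= (1 + a) * (1 - Cmod (moeb a x) ^ 2).
Proof.
  intros Hx. pose proof (moeb_identity x Hx) as E. pose proof (moeb_den_le x Hx) as L.
  pose proof (moeb_lt_1 x Hx) as M. pose proof (Cmod_ge_0 (moeb a x)).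
  pose proof (Cmod_ge_0 (1 - RtoC a * x)%C).
  assert (0 <= 1 - Cmod (moeb a x) ^ 2) by nra.
  assert (Cmod (1 - RtoC a * x)%C ^ 2 <= (1 + a) ^ 2) by (apply pow_incr; lra).
  apply Rmult_le_reg_l with (1 + a); [lra|].
  replace ((1 + a) * ((1 - a) * (1 - Cmod x ^ 2))) with ((1 - a ^ 2) * (1 - Cmod x ^ 2)) by ring.
  rewrite <- E. nra.
Qed.

Lemma moeb_inj x y : Cmod x < 1 -> Cmod y < 1 -> moeb a x = moeb a y -> x = y.
Proof.
  intros Hx Hy E. pose proof (moeb_den x Hx) as N1. pose proof (moeb_den y Hy) as N2. unfold moeb in E.
  assert (E1 : ((x - RtoC a) * (1 - RtoC a * y))%C = ((y - RtoC a) * (1 - RtoC a * x))%C).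
  { replace (x - RtoC a)%C with ((x - RtoC a) / (1 - RtoC a * x) * (1 - RtoC a * x))%C by (field; exact N1).
    rewrite E. field. exact N2. }
  assert (E2 : (RtoC (1 - a ^ 2) * (x - y))%C = 0%C).
  { replace (RtoC (1 - a ^ 2)) with (1 - RtoC a * RtoC a)%C
      by (rewrite <- RtoC_mult, <- RtoC_minus; f_equal; ring).
    replace ((1 - RtoC a * RtoC a) * (x - y))%C with
      ((x - RtoC a) * (1 - RtoC a * y) - (y - RtoC a) * (1 - RtoC a * x))%C by ring.
    rewrite E1. ring. }
  assert (N : RtoC (1 - a ^ 2) <> 0%C) by (intros Z; apply RtoC_inj in Z; nra).
  replace x with (/ RtoC (1 - a ^ 2) * (RtoC (1 - a ^ 2) * (x - y)) + y)%C by (field; exact N).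
  rewrite E2. ring.
Qed.

(* The inverse Moebius map does not decrease the modulus below [a] on the half-disc [Re v >= 0], so one
   of the two square roots of [w] is attained outside the disc of radius [a]. *)
Lemma moeb_surj v : Cmod v < 1 -> 0 <= Re v -> exists x, a <= Cmod x < 1 /\ moeb a x = v.
Proof.
  intros Hv Hr.
  assert (N : (1 + RtoC a * v)%C <> 0%C).
  { intros Z. assert (Re (1 + RtoC a * v)%C = 0) by (rewrite Z; reflexivity).
    destruct v. unfold Re in *. simpl in *. nra. }
  pose proof N as N'. apply Cmod_gt_0 in N'.
  assert (V2 : Re v ^ 2 + Im v ^ 2 < 1) by (apply Cmod_lt_1_sq; exact Hv).
  assert (S1 : Cmod (v + RtoC a)%C ^ 2 = Re v ^ 2 + Im v ^ 2 + 2 * a * Re v + a ^ 2)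
    by (rewrite Cmod2_alt; destruct v; unfold Re, Im; simpl; ring).
  assert (S2 : Cmod (1 + RtoC a * v)%C ^ 2 = 1 + 2 * a * Re v + a ^ 2 * (Re v ^ 2 + Im v ^ 2))
    by (rewrite Cmod2_alt; destruct v; unfold Re, Im; simpl; ring).
  pose proof (pow2_ge_0 (Re v)). pose proof (pow2_ge_0 (Im v)).
  pose proof (Cmod_ge_0 (v + RtoC a)%C).
  assert (Hlt : Cmod (v + RtoC a)%C < Cmod (1 + RtoC a * v)%C).
  { apply Rsqr_incrst_0; [|apply Cmod_ge_0|lra]. rewrite !Rsqr_pow2, S1, S2.
    assert (0 < 1 - a ^ 2) by nra. nra. }
  assert (Hge : a * Cmod (1 + RtoC a * v)%C <= Cmod (v + RtoC a)%C).
  { apply Rsqr_incr_0; [|nra|lra]. rewrite Rsqr_mult, !Rsqr_pow2, S1, S2.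
    assert (0 < 1 - a ^ 2) by nra. assert (0 < 1 - a ^ 4) by nra.
    assert (0 <= (1 - a ^ 4) * (Re v ^ 2 + Im v ^ 2)) by (apply Rmult_le_pos; lra).
    assert (0 <= 2 * a * ((1 - a ^ 2) * Re v)) by (apply Rmult_le_pos; [lra|apply Rmult_le_pos; lra]).
    nra. }
  exists ((v + RtoC a) / (1 + RtoC a * v))%C.
  assert (HX : a <= Cmod ((v + RtoC a) / (1 + RtoC a * v))%C < 1).
  { rewrite Cmod_div by exact N. split.
    - apply Rmult_le_reg_r with (Cmod (1 + RtoC a * v)%C); [lra|].
      unfold Rdiv. rewrite Rmult_assoc, Rinv_l by lra. lra.
    - apply Rmult_lt_reg_r with (Cmod (1 + RtoC a * v)%C); [lra|].
      unfold Rdiv. rewrite Rmult_assoc, Rinv_l by lra. lra. }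
  split; [exact HX|].
  pose proof (moeb_den _ (proj2 HX)) as N2. unfold moeb.
  assert (N3 : RtoC (1 - a ^ 2) <> 0%C) by (intros Z; apply RtoC_inj in Z; nra).
  assert (N4 : (1 + RtoC a * v - RtoC a * (v + RtoC a))%C <> 0%C).
  { replace (1 + RtoC a * v - RtoC a * (v + RtoC a))%C with (RtoC (1 - a ^ 2)); [exact N3|].
    replace (RtoC (1 - a ^ 2)) with (1 - RtoC a * RtoC a)%C
      by (rewrite <- RtoC_mult, <- RtoC_minus; f_equal; ring). ring. }
  field; split; assumption.
Qed.

Lemma moeb_cderiv x : Cmod x < 1 -> exists l, cderiv (moeb a) x l.
Proof.
  intros Hx. eexists.
  apply cderiv_ext with (fun y => (y + RtoC (- a)) * / (1 + RtoC (- a) * y))%C.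
  - intros y. unfold moeb, Cdiv. rewrite RtoC_opp.
    replace (1 + - RtoC a * y)%C with (1 - RtoC a * y)%C by ring. reflexivity.
  - apply cderiv_mult.
    + apply cderiv_plus; [apply cderiv_id|apply cderiv_const].
    + apply (cderiv_inv (fun y => 1 + RtoC (- a) * y)%C).
      * replace (1 + RtoC (- a) * x)%C with (1 - RtoC a * x)%C by (rewrite RtoC_opp; ring).
        apply moeb_den, Hx.
      * apply cderiv_plus; [apply cderiv_const|apply cderiv_scal, cderiv_id].
Qed.

End Moebius.

(** * The four-valent map *)

Lemma Cnorm_Cmod z : Cnorm z = Cmod z.
Proof. unfold Cnorm, Cmod. f_equal. simpl. ring. Qed.

Lemma Defs_Cdiv z w : Defs.Cdiv z w = (z / w)%C.
Proof.
  unfold Defs.Cdiv, Defs.Cinv, Defs.Cmul, Cdiv, Cmult, Cinv. cbn [fst snd].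
  replace (fst w ^ 2 + snd w ^ 2) with (fst w * fst w + snd w * snd w) by ring. reflexivity.
Qed.

Lemma inD_Cmod z : inD z <-> Cmod z < 1.
Proof. unfold inD. rewrite Cnorm_Cmod. tauto. Qed.

Lemma Cmod_lt_Re z : Cmod z < 1 -> Re z < 1.
Proof. pose proof (Re_le z). lra. Qed.

Lemma analytic_of_cderiv (f : C -> C) :
  (forall z, Cmod z < 1 -> exists l, cderiv f z l) -> analytic_on_D f.
Proof.
  intros H z Hz. apply inD_Cmod in Hz. destruct (H z Hz) as (l & A & d & HA & Hd & HL).
  exists l. intros eps He. exists (Rmin d (eps / (A + 1))).
  split; [apply Rmin_pos; [lra|apply Rdiv_lt_0_compat; lra]|].
  intros w Hw _. rewrite !Cnorm_Cmod in *. rewrite Defs_Cdiv.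
  pose proof (Rmin_l d (eps / (A + 1))). pose proof (Rmin_r d (eps / (A + 1))).
  change (Cadd z w) with (z + w)%C. change (Csub (f (z + w)%C) (f z)) with (f (z + w) - f z)%C.
  match goal with |- context [Csub ?x l] => change (Csub x l) with (x - l)%C end.
  assert (N : (w : C) <> RtoC 0) by (apply Cmod_gt_0; lra).
  replace ((f (z + w) - f z) / w - l)%C with ((f (z + w) - f z - l * w) / w)%C by (field; exact N).
  rewrite Cmod_div by exact N. specialize (HL w ltac:(lra)).
  apply Rle_lt_trans with (A * Cmod w).
  - apply Rmult_le_reg_r with (Cmod w); [lra|]. unfold Rdiv. rewrite Rmult_assoc, Rinv_l by lra. lra.
  - apply Rle_lt_trans with (A * (eps / (A + 1))); [apply Rmult_le_compat_l; lra|].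
    apply Rmult_lt_reg_r with (A + 1); [lra|].
    replace (A * (eps / (A + 1)) * (A + 1)) with (A * eps) by (field; lra). nra.
Qed.

(** * Radial limits and small boundary arcs *)

Lemma Cmod_expi t : Cmod (expi t) = 1.
Proof.
  transitivity (sqrt 1); [|apply sqrt_1]. unfold expi, Cmod. f_equal. simpl.
  pose proof (sin2_cos2 t) as T. unfold Rsqr in T. lra.
Qed.

(** The formula defining [psi] remains differentiable at the points of the circle other than 1, so
    there a radial limit can only be the value of the formula. *)
Lemma radial_limit_cderiv (f : C -> C) (t : R) (l l' : C) :
  cderiv f (expi t) l' -> radial_limit f t l -> l = f (expi t).
Proof.
  intros Hf Hl. destruct (cderiv_lip _ _ _ Hf) as (M & d & HM & Hd & HL).
  destruct (Req_dec (Cmod (l - f (expi t))%C) 0) as [Z|Z].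
  { apply Cmod_eq_0 in Z. replace l with (l - f (expi t) + f (expi t))%C by ring. rewrite Z.
    generalize (f (expi t)). intros u. ring. }
  exfalso. set (e := Cmod (l - f (expi t))%C) in *.
  assert (He : 0 < e) by (pose proof (Cmod_ge_0 (l - f (expi t))%C); unfold e in *; lra).
  destruct (Hl (e / 2) ltac:(lra)) as (d' & Hd' & HR).
  set (h := Rmin (d / 2) (Rmin (d' / 2) (e / (2 * (M + 1))))).
  assert (Hh : 0 < h) by (repeat apply Rmin_pos; try lra; apply Rdiv_lt_0_compat; lra).
  assert (h <= d / 2 /\ h <= d' / 2 /\ h <= e / (2 * (M + 1))) as (H1 & H2 & H3).
  { pose proof (Rmin_l (d / 2) (Rmin (d' / 2) (e / (2 * (M + 1))))).
    pose proof (Rmin_r (d / 2) (Rmin (d' / 2) (e / (2 * (M + 1))))).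
    pose proof (Rmin_l (d' / 2) (e / (2 * (M + 1)))). pose proof (Rmin_r (d' / 2) (e / (2 * (M + 1)))).
    unfold h. lra. }
  specialize (HR (1 - h) ltac:(lra)). rewrite Cnorm_Cmod in HR.
  pose proof (Cmod_expi t) as E1.
  specialize (HL (RtoC (- h) * expi t)%C). rewrite Cmod_mult, Cmod_R, Rabs_Ropp, Rabs_pos_eq, E1 in HL by lra.
  specialize (HL ltac:(lra)).
  assert (E2 : (expi t + RtoC (- h) * expi t)%C = Cscal (1 - h) (expi t)).
  { unfold Cscal. destruct (expi t). apply injective_projections; simpl; ring. }
  rewrite E2 in HL. change (Csub (f (Cscal (1 - h) (expi t))) l) with (f (Cscal (1 - h) (expi t)) - l)%C in HR.
  pose proof (Cmod_minus_triangle (f (Cscal (1 - h) (expi t)) - f (expi t))%C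
    (f (Cscal (1 - h) (expi t)) - l)%C) as T.
  replace (f (Cscal (1 - h) (expi t)) - f (expi t) - (f (Cscal (1 - h) (expi t)) - l))%C
    with (l - f (expi t))%C in T by ring. fold e in T.
  assert (M * (h * 1) < e / 2); [|lra].
  apply Rle_lt_trans with (M * (e / (2 * (M + 1)))); [apply Rmult_le_compat_l; lra|].
  apply Rmult_lt_reg_r with (2 * (M + 1)); [lra|].
  replace (M * (e / (2 * (M + 1))) * (2 * (M + 1))) with (M * e) by (field; lra). nra.
Qed.

Lemma sin_ge_half x : 0 <= x <= PI / 2 -> x / 2 <= sin x.
Proof.
  intros Hx. pose proof PI_lt. destruct (pre_sin_bound x 0) as (H1 & _); [lra|lra|].
  eapply Rle_trans; [|exact H1]. unfold sin_approx, sin_term. simpl. nra.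
Qed.

(** Since [sin (t / 2) >= t / 4] up to [PI], and symmetrically beyond, such [t] lie within [4 e] of
    0 or [2 * PI]. The two intervals have total length [16 e], less than [2 * PI * (3 e)]; the first
    also covers the endpoint [t = 0]. *)
Lemma m_le_arc (E : R -> Prop) (e c : R) : 0 < e -> 3 * e <= c ->
  (forall t, 0 < t < 2 * PI -> E t -> sin (t / 2) < e) -> m_le E c.
Proof.
  intros He Hc H eps Heps. pose proof PI2_3_2 as HPI.
  exists (fun n => match n with O => - (4 * e) | 1%nat => 2 * PI - 4 * e | _ => 0 end).
  exists (fun n => match n with O => 4 * e | 1%nat => 2 * PI + 4 * e | _ => 0 end).
  split; [intros [|[|n]]; lra|]. split.
  - intros t (Ht & HE). destruct (Req_dec t 0) as [Z|Z]; [exists 0%nat; lra|].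
    specialize (H t ltac:(lra) HE). destruct (Rle_dec t PI) as [T|T].
    + exists 0%nat. pose proof (sin_ge_half (t / 2) ltac:(lra)). lra.
    + exists 1%nat. pose proof (sin_ge_half (PI - t / 2) ltac:(lra)) as S.
      rewrite sin_PI_x in S. lra.
  - assert (S : forall N, sum_f_R0 (fun n => match n with O => 4 * e | 1%nat => 2 * PI + 4 * e | _ => 0 end -
      match n with O => - (4 * e) | 1%nat => 2 * PI - 4 * e | _ => 0 end) N <= 16 * e).
    { intros N. destruct N as [|N]; [simpl; lra|]. induction N as [|N IH]; [simpl; lra|].
      rewrite tech5. lra. }
    intros N. eapply Rle_trans; [apply S|]. nra.
Qed.

Lemma Cmod_1_minus_expi t : 0 <= t <= 2 * PI -> Cmod (1 - expi t)%C = 2 * sin (t / 2).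
Proof.
  intros Ht. assert (H : 0 <= sin (t / 2)) by (apply sin_ge_0; lra).
  unfold Cmod. rewrite <- (sqrt_pow2 (2 * sin (t / 2))) by lra. f_equal. unfold expi. simpl.
  pose proof (sin2_cos2 t) as T. unfold Rsqr in T.
  assert (E : cos t = 1 - 2 * sin (t / 2) * sin (t / 2)).
  { rewrite <- cos_2a_sin. f_equal. field. }
  nra.
Qed.

(** * Valence, covering and boundary values on the disc *)

Section Final.
Variable r : nat -> R.
Hypothesis r0 : r 0%nat = 10000.
Hypothesis rge : forall n, 10000 <= r n.
Variable F : C -> C.
Hypothesis HF : forall s, -1 < Re s -> cderiv F s (field_F r s).
Hypothesis Hlim : forall y eps, Rabs y <= 2 -> 0 < eps ->
    exists S, 0 <= S /\ forall x, S <= x -> Rabs (Re (F (x, y))) < eps.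

Definition phi (z : C) : C := cexp (- F (slog z)).

Lemma Cmod_phi z : Cmod (phi z) = exp (- Re (F (slog z))).
Proof. unfold phi. rewrite Cmod_cexp. destruct (F (slog z)). reflexivity. Qed.

Lemma phi_lt_1 z : Re z < 1 -> Cmod z <= 1 -> Cmod (phi z) < 1.
Proof.
  intros H1 H2. rewrite Cmod_phi. rewrite <- exp_0. apply exp_increasing.
  pose proof (Re_map_pos r r0 rge F HF Hlim _ (slog_strip z H1 H2)). lra.
Qed.

Lemma phi_cderiv z : Re z < 1 -> Cmod z <= 1 -> exists l, cderiv phi z l.
Proof.
  intros H1 H2. destruct (slog_cderiv z H1) as (m & Hm). eexists.
  apply (cderiv_comp cexp (fun x => - F (slog x))%C); [|apply cexp_cderiv].
  apply cderiv_ext with (fun x => - (1) * F (slog x))%C; [intros x; ring|].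
  apply cderiv_scal. apply cderiv_comp; [exact Hm|]. apply HF, strip_gt, slog_strip; assumption.
Qed.

(** The heights [Im (slog z)] differ by less than [PI] and [q <= 3.3], so the values of [Im F]
    differ by less than [4 * PI]. The difference 0 is excluded because [level_set] then identifies
    the points. *)
Lemma phi_eq z z' : Cmod z < 1 -> Cmod z' < 1 -> phi z = phi z' -> z <> z' ->
  Im (F (slog z)) - Im (F (slog z')) = 2 * PI \/ Im (F (slog z)) - Im (F (slog z')) = - (2 * PI).
Proof.
  intros H H' E N. unfold phi in E.
  pose proof (Cmod_lt_Re z H) as R1. pose proof (Cmod_lt_Re z' H') as R2.
  pose proof (slog_strip z R1 ltac:(lra)) as S1. pose proof (slog_strip z' R2 ltac:(lra)) as S2.
  assert (ER : Re (F (slog z')) = Re (F (slog z))).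
  { assert (X : Re (- F (slog z))%C = Re (- F (slog z'))%C)
      by (apply exp_inv; rewrite <- !Cmod_cexp, E; reflexivity).
    revert X. destruct (F (slog z)), (F (slog z')). unfold Re. simpl. lra. }
  destruct (level_set r r0 rge F HF _ _ S2 S1 ER) as (q & Hq & EL & HI).
  pose proof (slog_im z) as I1. pose proof (slog_im z') as I2.
  assert (B : Rabs (Im (- F (slog z))%C - Im (- F (slog z'))%C) < 4 * PI).
  { replace (Im (- F (slog z))%C - Im (- F (slog z'))%C) with (- (Im (F (slog z)) - Im (F (slog z'))))
      by (destruct (F (slog z)), (F (slog z')); unfold Im; simpl; ring).
    rewrite Rabs_Ropp, EL, Rabs_mult, Rabs_Ropp, (Rabs_pos_eq q) by lra.
    assert (D : Rabs (Im (slog z) - Im (slog z')) < PI) by (apply Rabs_lt_between; lra).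
    pose proof (Rabs_pos (Im (slog z) - Im (slog z'))). nra. }
  destruct (cexp_eq _ _ E B) as (_ & D).
  replace (Im (- F (slog z))%C - Im (- F (slog z'))%C) with (- (Im (F (slog z)) - Im (F (slog z'))))
    in D by (destruct (F (slog z)), (F (slog z')); unfold Im; simpl; ring).
  destruct D as [D|[D|D]]; [exfalso|right; lra|left; lra].
  apply N. apply slog_inj; try assumption. symmetry. apply HI.
  assert (q * (Im (slog z) - Im (slog z')) = 0) as Z by lra.
  apply Rmult_integral in Z. lra.
Qed.

(** Three numbers cannot have all pairwise differences equal to [2 * PI] or [- (2 * PI)]: the sum of
    two of these is 0 or has modulus [4 * PI]. *)
Lemma phi_two_valent x y z : Cmod x < 1 -> Cmod y < 1 -> Cmod z < 1 ->
  phi x = phi y -> phi y = phi z -> x <> y -> y <> z -> x <> z -> False.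
Proof.
  intros Hx Hy Hz E1 E2 N1 N2 N3. pose proof PI_RGT_0.
  pose proof (phi_eq x y Hx Hy E1 N1). pose proof (phi_eq y z Hy Hz E2 N2).
  pose proof (phi_eq x z Hx Hz (eq_trans E1 E2) N3). lra.
Qed.

Lemma phi_covers : exists rho, 0 < rho < 1 /\ forall x, rho < Cmod x < 1 ->
  exists z, Cmod z < 1 /\ phi z = x.
Proof.
  assert (Hc : 0 < cos (5 / 4)) by (pose proof PI2_3_2; apply cos_gt_0; lra).
  (* From this abscissa on, [exp (- Re s) < cos (5 / 4) <= cos (Im s)] whenever [|Im s| <= 5/4], so
     such [s] belong to the range of [slog]. *)
  set (x0 := Rmax 0 (1 - ln (cos (5 / 4)))).
  assert (Hx0 : exp (- x0) < cos (5 / 4)).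
  { rewrite <- (exp_ln (cos (5 / 4))) at 1 by exact Hc. apply exp_increasing.
    pose proof (Rmax_r 0 (1 - ln (cos (5 / 4)))). unfold x0. lra. }
  destruct (map_covers r r0 rge F HF Hlim x0 (Rmax_l _ _)) as (M & HM & Hcov).
  exists (exp (- M)). split.
  { split; [apply exp_pos|]. rewrite <- exp_0. apply exp_increasing. lra. }
  intros x (Hx1 & Hx2). pose proof (exp_pos (- M)).
  destruct (polar_exists x) as (y & Hy); [apply Cmod_gt_0; lra|].
  assert (L1 : ln (Cmod x) < 0) by (rewrite <- ln_1; apply ln_increasing; lra).
  assert (L2 : - M < ln (Cmod x)) by (rewrite <- (ln_exp (- M)); apply ln_increasing; lra).
  destruct (Hcov (- ln (Cmod x)) (- y)) as (s & k & Hs1 & Hs2 & Hs3 & Hs4); [lra|].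
  destruct (slog_surj s Hs2) as (z & Hz & Ez).
  - apply Rle_lt_trans with (exp (- x0)).
    { destruct Hs1 as [Hs1|Hs1]; [left; apply exp_increasing; lra|rewrite Hs1; lra]. }
    eapply Rlt_le_trans; [exact Hx0|]. pose proof PI2_3_2. apply Rabs_le_between in Hs2 as Hs2'.
    destruct (Rle_dec 0 (Im s)).
    + apply cos_decr_1; lra.
    + rewrite <- (cos_neg (Im s)). apply cos_decr_1; lra.
  - exists z. split; [exact Hz|]. unfold phi. rewrite Ez.
    replace (- F s)%C with ((ln (Cmod x), y + 2 * PI * IZR (- k)) : C).
    + rewrite cexp_period. symmetry. exact Hy.
    + rewrite opp_IZR. revert Hs3 Hs4. destruct (F s). unfold Re, Im. simpl. intros -> ->.
      apply injective_projections; simpl; ring.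
Qed.

Variable a : R.
Hypothesis Ha : 0 < a < 1.

Definition psi (z : C) : C := (moeb a (phi z) * moeb a (phi z))%C.

Lemma psi_cderiv z : Re z < 1 -> Cmod z <= 1 -> exists l, cderiv psi z l.
Proof.
  intros H1 H2. destruct (phi_cderiv z H1 H2) as (l & Hl).
  destruct (moeb_cderiv a Ha (phi z) (phi_lt_1 z H1 H2)) as (m & Hm).
  pose proof (cderiv_comp _ _ _ _ _ Hl Hm) as HC.
  eexists. apply cderiv_mult; exact HC.
Qed.

Lemma psi_onto : (forall x, a <= Cmod x < 1 -> exists z, Cmod z < 1 /\ phi z = x) ->
  maps_D_onto_D psi.
Proof.
  intros Hcov. split.
  - intros z Hz. apply inD_Cmod in Hz. apply inD_Cmod. unfold psi. rewrite Cmod_mult.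
    pose proof (moeb_lt_1 a Ha _ (phi_lt_1 z (Cmod_lt_Re z Hz) ltac:(lra))).
    pose proof (Cmod_ge_0 (moeb a (phi z))). nra.
  - intros w Hw. apply inD_Cmod in Hw. destruct (csqrt_exists w) as (v & Hv & Hr).
    assert (Hv1 : Cmod v < 1).
    { rewrite <- Hv, Cmod_mult in Hw. pose proof (Cmod_ge_0 v). nra. }
    destruct (moeb_surj a Ha v Hv1 Hr) as (x & Hx & Ex).
    destruct (Hcov x Hx) as (z & Hz & Ez). exists z. split; [apply inD_Cmod, Hz|].
    unfold psi. rewrite Ez, Ex. exact Hv.
Qed.

Lemma Cmult_self_eq (x y : C) : (x * x)%C = (y * y)%C -> x = y \/ x = (- y)%C.
Proof.
  intros E. assert (P : ((x - y) * (x + y))%C = 0%C).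
  { replace ((x - y) * (x + y))%C with (x * x - y * y)%C by ring. rewrite E. ring. }
  destruct (excluded_middle_informative ((x - y)%C = 0%C)) as [Z|Z].
  - left. replace x with (x - y + y)%C by ring. rewrite Z. ring.
  - right. destruct (excluded_middle_informative ((x + y)%C = 0%C)) as [Z'|Z'].
    + replace x with (x + y - y)%C by ring. rewrite Z'. ring.
    + exfalso. exact (Cmult_neq_0 _ _ Z Z' P).
Qed.

Lemma moeb_phi_two_valent x y z : Cmod x < 1 -> Cmod y < 1 -> Cmod z < 1 ->
  moeb a (phi x) = moeb a (phi y) -> moeb a (phi y) = moeb a (phi z) ->
  x <> y -> y <> z -> x <> z -> False.
Proof.
  intros Hx Hy Hz E1 E2 N1 N2 N3.
  assert (L : forall u, Cmod u < 1 -> Cmod (phi u) < 1).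
  { intros u Hu. apply phi_lt_1; [apply Cmod_lt_Re, Hu|lra]. }
  apply (phi_two_valent x y z); try assumption; apply (moeb_inj a Ha); auto.
Qed.

(** For five preimages, each value of [moeb a (phi _)] is plus or minus the value at the first one.
    Three of the five then share a sign, against two-valence. *)
Lemma psi_four_valent : four_valent psi.
Proof.
  intros w l ND Hl.
  assert (HV : forall z, In z l -> Cmod z < 1 /\ psi z = w).
  { intros z Hz. destruct (Hl z Hz) as (H1 & H2). split; [apply inD_Cmod, H1|exact H2]. }
  clear Hl. destruct l as [|z1 [|z2 [|z3 [|z4 [|z5 l]]]]]; simpl; try lia. exfalso.
  destruct (HV z1) as (B1 & E1); [simpl; tauto|].
  destruct (HV z2) as (B2 & E2); [simpl; tauto|].
  destruct (HV z3) as (B3 & E3); [simpl; tauto|].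
  destruct (HV z4) as (B4 & E4); [simpl; tauto|].
  destruct (HV z5) as (B5 & E5); [simpl; tauto|]. clear HV.
  apply NoDup_cons_iff in ND as (N1 & ND). apply NoDup_cons_iff in ND as (N2 & ND).
  apply NoDup_cons_iff in ND as (N3 & ND). apply NoDup_cons_iff in ND as (N4 & _).
  simpl in N1, N2, N3, N4.
  assert (z1 <> z2 /\ z1 <> z3 /\ z1 <> z4 /\ z1 <> z5) as (D12 & D13 & D14 & D15)
    by (repeat split; intros Q; apply N1; subst; tauto).
  assert (z2 <> z3 /\ z2 <> z4 /\ z2 <> z5) as (D23 & D24 & D25)
    by (repeat split; intros Q; apply N2; subst; tauto).
  assert (z3 <> z4 /\ z3 <> z5) as (D34 & D35)
    by (repeat split; intros Q; apply N3; subst; tauto).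
  assert (D45 : z4 <> z5) by (intros Q; apply N4; subst; tauto).
  rewrite <- E1 in E2, E3, E4, E5. clear E1 N1 N2 N3 N4. unfold psi in E2, E3, E4, E5.
  apply Cmult_self_eq in E2, E3, E4, E5.
  pose proof moeb_phi_two_valent as T.
  destruct E2, E3, E4, E5;
  let go x y z := apply (T x y z); solve [assumption | congruence] in
  first [ go z1 z2 z3 | go z1 z2 z4 | go z1 z2 z5 | go z1 z3 z4 | go z1 z3 z5 | go z1 z4
    z5 | go z2 z3 z4 | go z2 z3 z5 | go z2 z4 z5 | go z3 z4 z5 ].
Qed.

(** If [Re F >= x], then [|phi| ^ 2 <= / (1 + 2 x) <= 1 - x], the last step using [x <= 1/2].
    Because of the square in [psi], the quantity [1 - |psi|] is precisely the defect treated by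
    [moeb_defect], so it is at least [x (1 - a) / (1 + a) > h]. *)
Lemma big_boundary_small (h x : R) (t : R) : 0 < t < 2 * PI -> 0 <= x <= 1 / 2 ->
  (1 + a) * h < (1 - a) * x ->
  big_boundary_set psi h t -> Re (F (slog (expi t))) < x /\ Re (expi t) < 1 /\ Cmod (expi t) <= 1.
Proof.
  intros Ht Hx Hh (l & Hl & Hn).
  pose proof (Cmod_expi t) as E1.
  assert (R1 : Re (expi t) < 1).
  { unfold expi, Re. simpl. replace t with (2 * (t / 2)) by field. rewrite cos_2a_sin.
    assert (0 < sin (t / 2)) by (apply sin_gt_0; lra). nra. }
  split; [|split; [exact R1|lra]].
  destruct (psi_cderiv (expi t) R1 ltac:(lra)) as (l' & Hd).
  rewrite (radial_limit_cderiv _ _ _ _ Hd Hl), Cnorm_Cmod in Hn. unfold psi in Hn. rewrite Cmod_mult in Hn.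
  pose proof (phi_lt_1 (expi t) R1 ltac:(lra)) as P1.
  pose proof (moeb_defect a Ha _ P1) as D.
  destruct (Rlt_le_dec (Re (F (slog (expi t)))) x) as [L|L]; [exact L|exfalso].
  assert (PX : Cmod (phi (expi t)) ^ 2 <= 1 - x).
  { rewrite Cmod_phi. set (X := Re (F (slog (expi t)))) in *.
    pose proof (exp_ineq1_le (2 * X)) as I. pose proof (exp_pos (- X)) as EX.
    assert (EE : exp (- X) ^ 2 * exp (2 * X) = 1).
    { simpl. rewrite Rmult_1_r, <- !exp_plus, <- exp_0. f_equal. ring. }
    assert (0 < exp (- X) ^ 2) by nra.
    assert (exp (- X) ^ 2 * (1 + 2 * x) <= 1).
    { rewrite <- EE. apply Rmult_le_compat_l; lra. }
    assert (1 <= (1 - x) * (1 + 2 * x)) by nra.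
    apply Rmult_le_reg_r with (1 + 2 * x); lra. }
  nra.
Qed.

End Final.

(** * Choice of the scales and of the poles for a given [delta] *)

Lemma pow_eighth_pos n : 0 < (1 / 8) ^ n.
Proof. apply pow_lt. lra. Qed.

Lemma pow_eighth_lt_1 n : (1 / 8) ^ S n < 1.
Proof.
  pose proof (pow_incr (1 / 8) 1 n ltac:(lra)) as H. rewrite pow1 in H.
  simpl. pose proof (pow_eighth_pos n). lra.
Qed.

(** Thresholds are sampled at powers of 1/8, a ratio below 1/4, so that [h] is eventually small
    compared with the lower bound [0.1 * (1 / 4) ^ n] for [Re F]. *)
Lemma pow_eighth_bracket (N : nat) (h : R) : 0 < h <= (1 / 8) ^ N ->
  exists n, (N <= n)%nat /\ (1 / 8) ^ S n < h <= (1 / 8) ^ n.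
Proof.
  intros Hh. destruct (pow_lt_1_zero (1 / 8)) with (y := h) as (m & Hm);
    [rewrite Rabs_pos_eq; lra|lra|].
  specialize (Hm (N + m)%nat ltac:(lia)). rewrite Rabs_pos_eq in Hm by (left; apply pow_eighth_pos).
  clear - Hh Hm. induction m as [|m IH].
  - rewrite Nat.add_0_r in Hm. lra.
  - destruct (Rlt_le_dec ((1 / 8) ^ (N + m)) h) as [H|H]; [apply IH; exact H|].
    exists (N + m)%nat. rewrite Nat.add_succ_r in Hm. split; [lia|lra].
Qed.

Lemma INR_lt_pow2 n : INR n < 2 ^ n.
Proof.
  induction n as [|n IH]; [simpl; lra|]. rewrite S_INR. simpl.
  assert (1 <= 2 ^ n) by (apply pow_R1_Rle; lra). lra.
Qed.

Theorem theorem3p1 (delta : R -> R)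
  (hdelta_range : forall h, 0 < h < 1 -> 0 < delta h < 1)
  (hdelta_mono : forall h1 h2, 0 < h1 < 1 -> 0 < h2 < 1 -> h1 <= h2 -> delta h1 <= delta h2) :
  exists (psi : Cpx -> Cpx) (h0 : R),
    analytic_on_D psi /\ maps_D_onto_D psi /\ four_valent psi /\
    0 < h0 < 1 /\
    forall h, 0 < h <= h0 -> m_le (big_boundary_set psi h) (delta h).
Proof.
  (* The index [S n] provides for [h] in the bracket above [(1 / 8) ^ S n], where monotonicity gives
     [delta ((1 / 8) ^ S n) <= delta h]. The divisor 3 matches [m_le_arc], and [pole r n >= r n]
     turns the logarithmic bound into one on [exp (- pole r n)]. *)
  set (r := fun n => match n with O => 10000
    | S _ => Rmax 10000 (- ln (delta ((1 / 8) ^ S n) / 3)) end).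
  assert (rge : forall n, 10000 <= r n) by (intros [|n]; [simpl; lra|apply Rmax_l]).
  assert (r0 : r 0%nat = 10000) by reflexivity.
  assert (rd : forall n, (1 <= n)%nat -> exp (- pole r n) <= delta ((1 / 8) ^ S n) / 3).
  { intros n Hn. destruct n as [|n]; [lia|].
    pose proof (pow_eighth_pos (S (S n))). pose proof (pow_eighth_lt_1 (S n)).
    destruct (hdelta_range ((1 / 8) ^ S (S n)) ltac:(lra)) as (D1 & _).
    rewrite <- (exp_ln (delta ((1 / 8) ^ S (S n)) / 3)) by lra.
    assert (L : - pole r (S n) <= ln (delta ((1 / 8) ^ S (S n)) / 3)).
    { assert (- ln (delta ((1 / 8) ^ S (S n)) / 3) <= r (S n)) by apply Rmax_r.
      specialize (rge (S n)). unfold pole. nra. }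
    destruct L as [L|L]; [left; apply exp_increasing, L|rewrite L; lra]. }
  destruct (exists_map r r0 rge) as (F & HF & Hlim).
  destruct (phi_covers r r0 rge F HF Hlim) as (rho & Hrho & Hcov).
  (* Strictly above [rho], so that the covered annulus contains all moduli from [a] on, [a]
     included. *)
  set (a := (1 + rho) / 2). assert (Ha : 0 < a < 1) by (unfold a; lra).
  destruct (INR_unbounded (10 * (1 + a) / (1 - a))) as (N0 & HN0).
  (* The successor keeps every index in use at least 1, where [r] was adapted to [delta]; index 0
     has the fixed value. *)
  set (N := S N0).
  assert (HN : 10 * (1 + a) < (1 - a) * 2 ^ N).
  { pose proof (INR_lt_pow2 N0) as P. apply Rmult_lt_reg_r with (/ (1 - a)); [apply Rinv_0_lt_compat; lra|].
    replace ((1 - a) * 2 ^ N * / (1 - a)) with (2 ^ N) by (field; lra). unfold N.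
    unfold Rdiv in HN0. simpl. assert (0 < 2 ^ N0) by (apply pow_lt; lra). lra. }
  exists (psi F a), ((1 / 8) ^ N).
  split; [|split; [|split; [|split]]].
  - apply analytic_of_cderiv. intros z Hz.
    apply (psi_cderiv r r0 rge F HF Hlim a Ha); [apply Cmod_lt_Re, Hz|lra].
  - apply (psi_onto r r0 rge F HF Hlim a Ha). intros x Hx. apply Hcov. unfold a in Hx. lra.
  - apply (psi_four_valent r r0 rge F HF Hlim a Ha).
  - split; [apply pow_eighth_pos|apply pow_eighth_lt_1].
  - intros h Hh. destruct (pow_eighth_bracket N h Hh) as (n & Hn & Hh1 & Hh2).
    pose proof (pow_eighth_pos (S n)) as E0. pose proof (pow_eighth_lt_1 N0) as E1. fold N in E1.
    pose proof (pow_eighth_lt_1 n) as E2.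
    apply m_le_arc with (e := exp (- pole r n)); [apply exp_pos| |].
    + pose proof (rd n ltac:(unfold N in Hn; lia)).
      pose proof (hdelta_mono ((1 / 8) ^ S n) h ltac:(lra) ltac:(lra) (Rlt_le _ _ Hh1)). lra.
    + intros t Ht Hb.
      assert (Hq : 0 < (1 / 4) ^ n <= 1).
      { split; [apply pow_lt; lra|].
        pose proof (pow_incr (1 / 4) 1 n ltac:(lra)) as H. rewrite pow1 in H. exact H. }
      (* As [(1 / 8) ^ n = (1 / 4) ^ n / 2 ^ n], the power [2 ^ n >= 2 ^ N] outweighs the loss
         [10 (1 + a) / (1 - a)] caused by the Moebius map and the constant 0.1. *)
      assert (Hx : (1 + a) * h < (1 - a) * (0.1 * (1 / 4) ^ n)).
      { assert (H8 : (1 / 8) ^ n * 2 ^ n = (1 / 4) ^ n).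
        { rewrite <- Rpow_mult_distr. f_equal. field. }
        assert (H2n : 2 ^ N <= 2 ^ n) by (apply Rle_pow; [lra|exact Hn]).
        pose proof (pow_eighth_pos n). rewrite <- H8.
        apply Rle_lt_trans with ((1 + a) * (1 / 8) ^ n); [apply Rmult_le_compat_l; lra|].
        replace ((1 - a) * (0.1 * ((1 / 8) ^ n * 2 ^ n))) with (0.1 * ((1 - a) * 2 ^ n) * (1 / 8) ^ n) by ring.
        apply Rmult_lt_compat_r; [assumption|].
        assert ((1 - a) * 2 ^ N <= (1 - a) * 2 ^ n) by (apply Rmult_le_compat_l; lra). lra. }
      destruct (big_boundary_small r r0 rge F HF Hlim a Ha h (0.1 * (1 / 4) ^ n) t Ht ltac:(lra) Hx Hb)
        as (B1 & B2 & B3).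
      pose proof (slog_strip _ B2 B3) as S1. pose proof (slog_re _ B2) as S2.
      rewrite Cmod_1_minus_expi in S2 by lra.
      (* Up to the pole distance [Re F] is too large for a big boundary value; beyond it,
         [sin (t / 2) = exp (- Re (slog (expi t)))] is already below [exp (- pole r n)]. *)
      destruct (Rle_lt_dec (Re (slog (expi t))) (pole r n)) as [L|L].
      * pose proof (Re_map_lower r r0 rge F HF Hlim _ n S1 L). lra.
      * replace (sin (t / 2)) with (exp (- Re (slog (expi t)))) by lra. apply exp_increasing. lra.
Qed.
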